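(* Let $M>0$ and $\alpha\in(0,1]$, and let $f=h+\overline{g}\in\mathcal{P}_{\mathcal{H}}^0(\alpha,M)$ with $h(z)=z+\sum_{n=2}^\infty a_nz^n$ and $g(z)=\sum_{n=2}^\infty b_nz^n$ for $z\in\mathbb{D}$. Then: (i) $f$ is starlike in $|z|<r^*$, where $r^*\in(0,1)$ is the smallest root of the equation $$G_{1,\alpha,M}(r):=r\,{}_2F_1\left(1,\tfrac{1}{\alpha};1+\tfrac{1}{\alpha}; r\right)-\frac{1}{2(M-\alpha+1)}=0;$$ (ii) $f$ is convex in $|z|<r_c$, where $r_c\in(0,1)$ is the smallest root of the equation $$G_{2,\alpha,M}(r):=\frac{r}{1-r}+(2\alpha-1)\,r\,{}_2F_1\left(1,\tfrac{1}{\alpha};1+\tfrac{1}{\alpha}; r\right)-\frac{\alpha}{2(M-\alpha+1)}=0.$$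
   Context: $\mathbb{D}=\{z\in\mathbb{C}:|z|<1\}$. $\mathcal{H}$ is the class of complex-valued harmonic functions $f=h+\overline{g}$ in $\mathbb{D}$, with $h,g$ analytic in $\mathbb{D}$ and $h(0)=h'(0)-1=0$, $g(0)=0$. For $M>0$ and $\alpha\in(0,1]$, $\mathcal{P}_{\mathcal{H}}^0(\alpha,M)$ is the class of all $f=h+\overline{g}\in\mathcal{H}$ with $g'(0)=0$ and $$\mathrm{Re}\left((1-\alpha)h'(z)+\alpha zh''(z)\right)>-M+\left|(1-\alpha)g'(z)+\alpha zg''(z)\right|\quad\text{for all } z\in\mathbb{D}.$$ A domain $\Omega$ is starlike if it is starlike with respect to $0$, i.e. $0\in\Omega$ and the segment from $0$ to any point of $\Omega$ lies in $\Omega$; it is convex if it is starlike with respect to each of its points. The function $f$ is starlike (resp. convex) in $|z|<r$ if the image $f(\{|z|<r\})$ is starlike (resp. convex). The Gaussian hypergeometric function is ${}_2F_1(a,b;c;z)=\sum_{n=0}^\infty \frac{(a)_n(b)_n}{(c)_n(1)_n}z^n$ for $|z|<1$, where $(a)_n$ is the Pochhammer symbol, $(a)_0=1$, $(a)_n=a(a+1)\cdots(a+n-1)$. *)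

(* Defs.v *)
From Stdlib Require Import Reals.
From Coquelicot Require Import Coquelicot.

Open Scope R_scope.

Definition unit_disk (z : C) : Prop := Cmod z < 1.

(* [ex_derive] is taken over the field C, so this is complex
   differentiability. *)
Definition analytic_on (D : C -> Prop) (h : C -> C) : Prop :=
  forall z : C, D z -> ex_derive (K := C_AbsRing) (V := C_NormedModule) h z.

(* f = h + conj g with h, g analytic: harmonicity of f is automatic, so it is
   not a separate clause. All functions are total; only their values on the
   unit disk matter. *)
Record class_H (f h g : C -> C) : Prop := {
  class_H_analytic_h : analytic_on unit_disk h;
  class_H_analytic_g : analytic_on unit_disk g;
  class_H_decomp : forall z : C, unit_disk z -> f z = (h z + Cconj (g z))%C;
  class_H_h0 : h 0%C = 0%C;
  class_H_dh0 : C_derive h 0%C = 1%C;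
  class_H_g0 : g 0%C = 0%C
}.

Record class_PH0 (alpha M : R) (f h g : C -> C) : Prop := {
  class_PH0_H : class_H f h g;
  class_PH0_dg0 : C_derive g 0%C = 0%C;
  class_PH0_ineq : forall z : C, unit_disk z ->
    Re ((1 - alpha)%R * C_derive h z
        + alpha * z * C_derive (C_derive h) z)%C
    > - M + Cmod ((1 - alpha)%R * C_derive g z
                  + alpha * z * C_derive (C_derive g) z)%C
}.

Definition has_tail_expansion (a : nat -> C) (z s : C) : Prop :=
  is_series (K := C_AbsRing) (V := C_NormedModule)
    (fun k : nat => (a (k + 2)%nat * z ^ (k + 2))%C) s.

Definition connected_set (Omega : C -> Prop) : Prop :=
  forall U V : C -> Prop,
    open (T := C_UniformSpace) U -> open (T := C_UniformSpace) V ->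
    (forall w, Omega w -> U w \/ V w) ->
    (exists w, Omega w /\ U w) ->
    (exists w, Omega w /\ V w) ->
    exists w, Omega w /\ U w /\ V w.

Definition is_domain (Omega : C -> Prop) : Prop :=
  (exists w, Omega w) /\
  open (T := C_UniformSpace) Omega /\
  connected_set Omega.

Definition starlike_wrt (w0 : C) (Omega : C -> Prop) : Prop :=
  Omega w0 /\
  forall (w : C) (t : R), Omega w -> 0 <= t <= 1 ->
    Omega ((1 - t)%R * w0 + t * w)%C.

Definition starlike_domain (Omega : C -> Prop) : Prop :=
  is_domain Omega /\ starlike_wrt 0%C Omega.

Definition convex_domain (Omega : C -> Prop) : Prop :=
  is_domain Omega /\ forall w0 : C, Omega w0 -> starlike_wrt w0 Omega.

Definition disk_image (f : C -> C) (r : R) : C -> Prop :=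
  fun w => exists z : C, Cmod z < r /\ w = f z.

Definition starlike_in_disk (f : C -> C) (r : R) : Prop :=
  starlike_domain (disk_image f r).

Definition convex_in_disk (f : C -> C) (r : R) : Prop :=
  convex_domain (disk_image f r).

Fixpoint pochhammer (a : R) (n : nat) : R :=
  match n with
  | O => 1
  | S m => pochhammer a m * (a + INR m)
  end.

(* [Series] is total: this is the Gauss function for |x| < 1 and c not a
   nonpositive integer, and only used there. *)
Definition hyp2F1 (a b c x : R) : R :=
  Series (fun n : nat =>
    pochhammer a n * pochhammer b n / (pochhammer c n * pochhammer 1 n)
    * x ^ n).

Definition G1 (alpha M r : R) : R :=
  r * hyp2F1 1 (1 / alpha) (1 + 1 / alpha) r - 1 / (2 * (M - alpha + 1)).

Definition G2 (alpha M r : R) : R :=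
  r / (1 - r)
  + (2 * alpha - 1) * r * hyp2F1 1 (1 / alpha) (1 + 1 / alpha) r
  - alpha / (2 * (M - alpha + 1)).

Definition smallest_root_01 (G : R -> R) (r : R) : Prop :=
  0 < r < 1 /\ G r = 0 /\ forall s : R, 0 < s < 1 -> G s = 0 -> r <= s.

(* Main.v *)
Require Import Defs.
From Stdlib Require Import Reals Ranalysis5 Lra Lia.
From Coquelicot Require Import Coquelicot.

(** Both [P = (1 - alpha) h' + alpha z h'' + M] and
    [Q = (1 - alpha) g' + alpha z g''] have known Taylor coefficients, and
    [Re (P + e Q) > 0] for every unimodular [e]. Caratheodory's inequality with
    the right [e] gives
    [n (1 + alpha (n - 2)) (|a_n| + |b_n|) <= 2 (M - alpha + 1)], so that
    [G1 r = 0] (resp. [G2 r = 0]) implies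
    [sum_{n >= 2} n (|a_n| + |b_n|) r^(n-1) <= 1] (resp. with [n^2]).

    Under these coefficient conditions [f - id] is a strict contraction on
    smaller disks, hence [f] is open with a uniform local inverse. Moreover, if
    [f z1 = t f z] with [0 <= t <= 1] then [|z1| <= |z|], because
    [|z1^n - t z^n| <= n |z1|^(n-1) |z1 - t z|] whenever [|z| <= |z1|];
    and if [f z = s f z1 + t f z2] with [s + t = 1] then
    [|z| <= max |z1| |z2|], because
    [|z^n - s z1^n - t z2^n| <= n^2 |z|^(n-1) |z - s z1 - t z2|] whenever
    [|z1|, |z2| <= |z|]. With these a priori bounds, preimages can be continued
    along the segments that starlikeness and convexity ask for. *)

Local Open Scope C_scope.

Local Notation is_Cseries :=
  (is_series (K := C_AbsRing) (V := C_NormedModule)).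

(** * Powers of complex numbers *)

(** The root equations are coefficient estimates in disguise: [r 2F1(1, 1/alpha; 1 + 1/alpha; r)] is
    the sum of [r^(n+1) / (1 + alpha n)], so at a root of [G1] the majorant of the coefficient sum
    is exactly 1; [G2] arises in the same way from one more factor [n]. The constant
    [2 (M - alpha + 1)] is twice the value [1 - alpha + M] of [P] at 0. Equality at the root leaves
    no room: the Lipschitz constant obtained for [f - id] on the disk of radius [rho] is [rho / r],
    which tends to 1 at the boundary. No uniform contraction is available on the whole disk, and
    this is why preimages must first be confined to a smaller closed disk. Both conclusions concern
    the image as a set, so it is enough to give every point of a segment some preimage. The roots
    lie below 1 for every admissible [M] because the series in question have coefficients at least a
    multiple of [1 / (n + 1)], hence diverge at 1. *)

Lemma Cmod_minus_sym (x y : C) : Cmod (x - y) = Cmod (y - x).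
Proof.
  rewrite <- Cmod_opp.
  f_equal; ring.
Qed.

Lemma Cmod_triangle_minus (x y : C) : (Cmod (x - y) <= Cmod x + Cmod y)%R.
Proof.
  unfold Cminus.
  rewrite <- (Cmod_opp y).
  apply Cmod_triangle.
Qed.

Lemma Cmod_minus_lower (x y : C) : (Cmod x - Cmod y <= Cmod (x - y))%R.
Proof.
  pose proof (Cmod_triangle (x - y) y) as H.
  replace (x - y + y) with x in H by ring.
  lra.
Qed.

Lemma Re_le_Cmod (z : C) : (Re z <= Cmod z)%R.
Proof.
  pose proof (re_le_Cmod z); pose proof (Rle_abs (Re z)); lra.
Qed.

Lemma Cmod_pow_le (z : C) (rho : R) (n : nat) :
  (Cmod z <= rho)%R -> (Cmod (z ^ n) <= rho ^ n)%R.
Proof.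
  intros Hz.
  rewrite Cmod_pow.
  apply pow_incr; split; [apply Cmod_ge_0 | exact Hz].
Qed.

Lemma Cpow_minus_bound (w z : C) (rho : R) (n : nat) :
  (Cmod w <= rho)%R -> (Cmod z <= rho)%R ->
  (Cmod (w ^ S n - z ^ S n) <= INR (S n) * rho ^ n * Cmod (w - z))%R.
Proof.
  intros Hw Hz.
  induction n as [|n IH].
  { rewrite !Cpow_1_r; simpl; lra. }
  replace (w ^ S (S n) - z ^ S (S n))
    with (w ^ S n * (w - z) + z * (w ^ S n - z ^ S n))
    by (rewrite !Cpow_S; ring).
  eapply Rle_trans; [apply Cmod_triangle|].
  rewrite !Cmod_mult, (S_INR (S n)).
  pose proof (Cmod_pow_le w rho (S n) Hw).
  pose proof (Cmod_ge_0 (w - z)).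
  pose proof (Cmod_ge_0 z).
  pose proof (Cmod_ge_0 (w ^ S n - z ^ S n)).
  assert (Cmod (w ^ S n) * Cmod (w - z) <= rho ^ S n * Cmod (w - z))%R
    by (apply Rmult_le_compat_r; assumption).
  assert (Cmod z * Cmod (w ^ S n - z ^ S n)
          <= rho * (INR (S n) * rho ^ n * Cmod (w - z)))%R
    by (apply Rmult_le_compat; assumption).
  change (rho ^ S n)%R with (rho * rho ^ n)%R in *.
  lra.
Qed.

(** Raising the exponent multiplies the remainder by [z] and adds a first-order difference times
    [w - z]; the constants add up since [(n+2) + (n+2)(n+1)/2 = (n+3)(n+2)/2]. It serves both the
    differentiation of power series and the expansion of convex combinations of powers. *)
Lemma Cpow_taylor2_bound (w z : C) (rho : R) (n : nat) :
  (Cmod w <= rho)%R -> (Cmod z <= rho)%R ->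
  (Cmod (w ^ S (S n) - z ^ S (S n) - INR (S (S n)) * z ^ S n * (w - z))
   <= INR (S (S n)) * INR (S n) / 2 * rho ^ n * Cmod (w - z) ^ 2)%R.
Proof.
  intros Hw Hz.
  induction n as [|n IH].
  { replace (w ^ 2 - z ^ 2 - INR 2 * z ^ 1 * (w - z)) with ((w - z) * (w - z)).
    - rewrite Cmod_mult; simpl; right; field.
    - replace (INR 2) with (1 + 1)%R by (simpl; ring).
      rewrite RtoC_plus; simpl; ring. }
  replace (w ^ S (S (S n)) - z ^ S (S (S n))
           - INR (S (S (S n))) * z ^ S (S n) * (w - z))
    with ((w ^ S (S n) - z ^ S (S n)) * (w - z)
          + z * (w ^ S (S n) - z ^ S (S n) - INR (S (S n)) * z ^ S n * (w - z)))
    by (rewrite (S_INR (S (S n))), RtoC_plus, !Cpow_S; ring).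
  eapply Rle_trans; [apply Cmod_triangle|].
  rewrite !Cmod_mult.
  pose proof (Cpow_minus_bound w z rho (S n) Hw Hz) as H1.
  pose proof (Cmod_ge_0 (w - z)) as Hd.
  pose proof (Cmod_ge_0 z).
  set (X := Cmod (w ^ S (S n) - z ^ S (S n) - _)) in *.
  assert (H0 : (0 <= X)%R) by apply Cmod_ge_0.
  apply (Rmult_le_compat_r _ _ _ Hd) in H1.
  assert (H2 : (Cmod z * X <= rho * (INR (S (S n)) * INR (S n) / 2 * rho ^ n
     * Cmod (w - z) ^ 2))%R) by (apply Rmult_le_compat; assumption).
  eapply Rle_trans; [apply Rplus_le_compat; eassumption|].
  right.
  rewrite (S_INR (S (S n))), (S_INR (S n)).
  simpl (rho ^ S n)%R; simpl (_ ^ 2)%R; field.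
Qed.

Lemma Cmod_sq (z : C) : (Cmod z * Cmod z = Re z * Re z + Im z * Im z)%R.
Proof.
  pose proof (Cmod2_alt z) as H.
  simpl in H; lra.
Qed.

Lemma Cmod_le_of_sq (z : C) (d : R) :
  (0 <= d)%R -> (Re z * Re z + Im z * Im z <= d * d)%R -> (Cmod z <= d)%R.
Proof.
  intros Hd H.
  rewrite <- Cmod_sq in H.
  pose proof (Cmod_ge_0 z); nra.
Qed.

(** The difference of squares is [(1-t) ((1+t) |z1|^2 - 2 t Re (z1 conj z))], and
    [Re (z1 conj z) <= |z1|^2] leaves at least [(1-t)^2 |z1|^2]. *)
Lemma Cmod_scaled_minus_le (z1 z : C) (t : R) :
  (0 <= t <= 1)%R -> (Cmod z <= Cmod z1)%R ->
  (t * Cmod (z1 - z) <= Cmod (z1 - t * z))%R.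
Proof.
  intros Ht Hz.
  replace (t * Cmod (z1 - z))%R with (Cmod (t * (z1 - z)))
    by (rewrite Cmod_mult, Cmod_R, Rabs_pos_eq; lra).
  apply Cmod_le_of_sq; [apply Cmod_ge_0|].
  rewrite Cmod_sq.
  pose proof (Cmod_sq z) as E; pose proof (Cmod_sq z1) as E1.
  pose proof (Cmod_ge_0 z); pose proof (Cmod_ge_0 z1).
  assert (Hsq : (Cmod z * Cmod z <= Cmod z1 * Cmod z1)%R) by nra.
  rewrite E, E1 in Hsq; clear - Hsq Ht.
  destruct z as [x y], z1 as [x1 y1]; unfold Re, Im in *; simpl in *.
  assert (2 * (x * x1 + y * y1) <= 2 * (x1 * x1 + y1 * y1))%R
    by (pose proof (Rle_0_sqr (x - x1)); pose proof (Rle_0_sqr (y - y1));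
        unfold Rsqr in *; lra).
  assert (0 <= t * (1 - t))%R by nra.
  assert (0 <= (1 - t) * (1 - t) * (x1 * x1 + y1 * y1))%R
    by (apply Rmult_le_pos;
        [|apply Rplus_le_le_0_compat]; apply Rle_0_sqr).
  assert (t * (1 - t) * (2 * (x * x1 + y * y1))
          <= t * (1 - t) * (2 * (x1 * x1 + y1 * y1)))%R
    by (apply Rmult_le_compat_l; assumption).
  lra.
Qed.

(** Splitting off [z1^n (z1 - t z)] leaves [t z (z1^n - z^n)], which is of order [t |z1 - z|]; the
    factor [t] is what allows a comparison with [|z1 - t z|]. *)
Lemma Cpow_starlike_bound (z1 z : C) (t : R) (n : nat) :
  (0 <= t <= 1)%R -> (Cmod z <= Cmod z1)%R ->
  (Cmod (z1 ^ S n - t * z ^ S n)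
   <= INR (S n) * Cmod z1 ^ n * Cmod (z1 - t * z))%R.
Proof.
  intros Ht Hz.
  destruct n as [|n].
  { rewrite !Cpow_1_r; simpl; lra. }
  replace (z1 ^ S (S n) - t * z ^ S (S n))
    with (z1 ^ S n * (z1 - t * z) + t * z * (z1 ^ S n - z ^ S n))
    by (rewrite !Cpow_S; ring).
  eapply Rle_trans; [apply Cmod_triangle|].
  rewrite !Cmod_mult, Cmod_R, Rabs_pos_eq, Cmod_pow by lra.
  pose proof (Cpow_minus_bound z1 z (Cmod z1) n (Rle_refl _) Hz) as H1.
  pose proof (Cmod_scaled_minus_le z1 z t Ht Hz) as H2.
  set (R1 := Cmod z1) in *.
  assert (HR : (0 <= R1)%R) by apply Cmod_ge_0.
  pose proof (Cmod_ge_0 z) as Hz0.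
  assert (Hn : (0 <= INR (S n) * R1 ^ n)%R)
    by (apply Rmult_le_pos; [apply pos_INR | apply pow_le, HR]).
  assert (t * Cmod z * Cmod (z1 ^ S n - z ^ S n)
          <= R1 * (INR (S n) * R1 ^ n * Cmod (z1 - t * z)))%R.
  { apply Rle_trans with (Cmod z * (INR (S n) * R1 ^ n * (t * Cmod (z1 - z))))%R.
    - replace (t * Cmod z * Cmod (z1 ^ S n - z ^ S n))%R
        with (t * Cmod z * (Cmod (z1 ^ S n - z ^ S n)))%R by ring.
      apply (Rmult_le_compat_l (t * Cmod z)) in H1; [lra|].
      apply Rmult_le_pos; lra.
    - apply Rmult_le_compat; try assumption.
      + apply Rmult_le_pos; [exact Hn|].
        apply Rmult_le_pos; [lra | apply Cmod_ge_0].
      + apply Rmult_le_compat_l; assumption. }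
  rewrite (S_INR (S n)).
  change (R1 ^ S n)%R with (R1 * R1 ^ n)%R.
  lra.
Qed.

(* [|z - zeta|^2 <= 2 Re (conj z (z - zeta))] when [|zeta| <= |z|], so the
   second-order remainders of a convex combination of powers are controlled
   by the first-order term. *)
Lemma Cpow_convex_bound (z z1 z2 : C) (s t : R) (n : nat) :
  (0 <= s)%R -> (0 <= t)%R -> (s + t = 1)%R ->
  (Cmod z1 <= Cmod z)%R -> (Cmod z2 <= Cmod z)%R ->
  (Cmod (z ^ S n - s * z1 ^ S n - t * z2 ^ S n)
   <= INR (S n) ^ 2 * Cmod z ^ n * Cmod (z - s * z1 - t * z2))%R.
Proof.
  intros Hs Ht Hst H1 H2.
  destruct n as [|n].
  { rewrite !Cpow_1_r; simpl; lra. }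
  set (D := z - s * z1 - t * z2).
  set (rem := fun zeta : C =>
    zeta ^ S (S n) - z ^ S (S n) - INR (S (S n)) * z ^ S n * (zeta - z)).
  assert (Est : RtoC s + RtoC t = 1) by (rewrite <- RtoC_plus, Hst; reflexivity).
  (* Since [s + t = 1], the first-order terms of the expansions about [z] combine into a multiple of
     [D]. *)
  replace (z ^ S (S n) - s * z1 ^ S (S n) - t * z2 ^ S (S n))
    with (INR (S (S n)) * z ^ S n * D - (s * rem z1 + t * rem z2)).
  2:{ unfold rem, D.
      replace (RtoC t) with (1 - RtoC s) by (rewrite <- Est; ring).
      ring. }
  assert (Hrem : forall zeta, (Cmod zeta <= Cmod z)%R ->
    (Cmod (rem zeta) <= INR (S (S n)) * INR (S n) * Cmod z ^ n
       * (Re (Cconj z * (z - zeta))))%R).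
  { intros zeta Hzeta.
    eapply Rle_trans;
      [apply (Cpow_taylor2_bound zeta z (Cmod z) n Hzeta (Rle_refl _))|].
    rewrite Cmod_minus_sym.
    assert (Hq : (Cmod (z - zeta) ^ 2 <= 2 * Re (Cconj z * (z - zeta)))%R).
    { simpl; rewrite Rmult_1_r, Cmod_sq.
      pose proof (Cmod_sq z) as E; pose proof (Cmod_sq zeta) as E1.
      pose proof (Cmod_ge_0 z); pose proof (Cmod_ge_0 zeta).
      assert (H' : (Cmod zeta * Cmod zeta <= Cmod z * Cmod z)%R) by nra.
      rewrite E, E1 in H'.
      destruct z as [x y], zeta as [x1 y1]; unfold Re, Im in *; simpl in *.
      nra. }
    assert (Hp : (0 <= INR (S (S n)) * INR (S n) / 2 * Cmod z ^ n)%R).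
    { apply Rmult_le_pos; [|apply pow_le, Cmod_ge_0].
      pose proof (pos_INR (S (S n))); pose proof (pos_INR (S n)).
      apply Rmult_le_pos; [apply Rmult_le_pos|]; lra. }
    apply (Rmult_le_compat_l _ _ _ Hp) in Hq.
    eapply Rle_trans; [exact Hq|].
    right; field. }
  assert (Hsum : (Cmod (s * rem z1 + t * rem z2)
     <= INR (S (S n)) * INR (S n) * Cmod z ^ n * (Cmod z * Cmod D))%R).
  { apply Rle_trans with
      (INR (S (S n)) * INR (S n) * Cmod z ^ n * Re (Cconj z * D))%R.
    - eapply Rle_trans; [apply Cmod_triangle|].
      rewrite !Cmod_mult, !Cmod_R, !Rabs_pos_eq by assumption.
      apply (Hrem z1), (Rmult_le_compat_l s) in H1; [|assumption].
      apply (Hrem z2), (Rmult_le_compat_l t) in H2; [|assumption].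
      replace (Re (Cconj z * D))
        with (s * Re (Cconj z * (z - z1)) + t * Re (Cconj z * (z - z2)))%R.
      + lra.
      + unfold D; clear - Hst.
        replace s with (1 - t)%R by lra.
        destruct z as [x y], z1 as [x1 y1], z2 as [x2 y2].
        unfold Re, Im; simpl; ring.
    - apply Rmult_le_compat_l.
      + apply Rmult_le_pos; [|apply pow_le, Cmod_ge_0].
        apply Rmult_le_pos; apply pos_INR.
      + eapply Rle_trans; [apply Re_le_Cmod|].
        rewrite Cmod_mult, Cmod_conj; lra. }
  eapply Rle_trans; [apply Cmod_triangle_minus|].
  eapply Rle_trans; [apply Rplus_le_compat_l, Hsum|].
  rewrite !Cmod_mult, Cmod_R, Cmod_pow, Rabs_pos_eq by apply pos_INR.
  (* The square in the statement is [(n+2) + (n+2)(n+1) = (n+2)^2]. *)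
  right; rewrite (S_INR (S n)).
  generalize (INR (S n)); intros x.
  simpl (_ ^ 2)%R; simpl (Cmod z ^ S n)%R; ring.
Qed.

(** * Complex power series on the unit disk *)

Lemma is_Cseries_ext (a b : nat -> C) (s : C) :
  (forall n, a n = b n) -> is_Cseries a s -> is_Cseries b s.
Proof. apply is_series_ext. Qed.

Lemma is_Cseries_plus (a b : nat -> C) (s t : C) :
  is_Cseries a s -> is_Cseries b t ->
  is_Cseries (fun n => a n + b n) (s + t).
Proof. apply (is_series_plus (V := C_NormedModule)). Qed.

Lemma is_Cseries_minus (a b : nat -> C) (s t : C) :
  is_Cseries a s -> is_Cseries b t ->
  is_Cseries (fun n => a n - b n) (s - t).
Proof. apply (is_series_minus (V := C_NormedModule)). Qed.

Lemma is_Cseries_scal (c : C) (a : nat -> C) (s : C) :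
  is_Cseries a s -> is_Cseries (fun n => c * a n) (c * s).
Proof. apply (is_series_scal (V := C_NormedModule)). Qed.

Lemma is_Cseries_tail (a : nat -> C) (s : C) :
  is_Cseries a s -> is_Cseries (fun n => a (S n)) (s - a O).
Proof.
  intros H.
  apply (is_series_incr_1 (V := C_NormedModule) a).
  replace (plus _ _) with s; [exact H|].
  change (s = s - a O + a O); ring.
Qed.

Lemma is_Cseries_cons (a : nat -> C) (s : C) :
  is_Cseries (fun n => a (S n)) s -> is_Cseries a (a O + s).
Proof.
  intros H.
  apply (is_series_decr_1 (V := C_NormedModule) a).
  replace (plus _ _) with s; [exact H|].
  change (s = a O + s - a O); ring.
Qed.

(** Conjugation is not linear over [C_AbsRing], so the limit is passed through by components: balls
    in [C_UniformSpace] are products, and only the sign of the imaginary part changes. *)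
Lemma is_Cseries_conj (a : nat -> C) (s : C) :
  is_Cseries a s -> is_Cseries (fun n => Cconj (a n)) (Cconj s).
Proof.
  intros H.
  apply filterlim_ext with (fun n => Cconj (sum_n (G := C_NormedModule) a n)).
  { induction x as [|n IH].
    - rewrite !sum_O; reflexivity.
    - rewrite !sum_Sn, <- IH.
      apply Cplus_conj. }
  eapply filterlim_comp; [exact H|].
  apply (filterlim_locally (U := C_UniformSpace)).
  intros eps; exists eps.
  intros y [H1 H2]; split; [exact H1|].
  unfold ball in *; simpl in *; unfold AbsRing_ball, minus, plus, opp, abs in *.
  simpl in *.
  rewrite <- Rabs_Ropp.
  replace (- _)%R with (snd y + - snd s)%R; [exact H2|ring].
Qed.

Lemma is_Cseries_single (k : nat) (x : C) :
  is_Cseries (fun n => if Nat.eq_dec n k then x else RtoC 0) x.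
Proof.
  assert (E : forall n, sum_n (G := C_NormedModule)
     (fun n => if Nat.eq_dec n k then x else RtoC 0) n
     = if Compare_dec.le_dec k n then x else RtoC 0).
  { induction n as [|n IH].
    - rewrite sum_O.
      destruct (Nat.eq_dec 0 k), (Compare_dec.le_dec k 0); try lia; reflexivity.
    - rewrite sum_Sn, IH.
      destruct (Nat.eq_dec (S n) k), (Compare_dec.le_dec k n),
        (Compare_dec.le_dec k (S n)); try lia;
        first [apply Cplus_0_l | apply Cplus_0_r]. }
  apply filterlim_ext_loc with (fun _ : nat => x).
  - exists k; intros n Hn.
    rewrite E; destruct (Compare_dec.le_dec k n); [reflexivity|lia].
  - apply filterlim_const.
Qed.

Lemma is_Cseries_bound (a : nat -> C) (b : nat -> R) (s : C) (t : R) :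
  is_Cseries a s -> is_series b t -> (forall n, (Cmod (a n) <= b n)%R) ->
  (Cmod s <= t)%R.
Proof.
  intros Ha Hb Hab.
  apply (is_lim_seq_le
    (fun n => norm (sum_n (G := C_NormedModule) a n)) (sum_n b) (Cmod s) t).
  - intros n.
    eapply Rle_trans; [apply (norm_sum_n_m (V := C_NormedModule))|].
    apply sum_n_m_le, Hab.
  - eapply filterlim_comp; [exact Ha|].
    apply (filterlim_norm (V := C_NormedModule)).
  - exact Hb.
Qed.

Lemma is_Cseries_bound_Series (a : nat -> C) (b : nat -> R) (s : C) :
  is_Cseries a s -> ex_series b -> (forall n, (Cmod (a n) <= b n)%R) ->
  (Cmod s <= Series b)%R.
Proof.
  intros Ha Hb; apply is_Cseries_bound; [exact Ha|].
  apply Series_correct, Hb.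
Qed.

Lemma is_Cseries_terms_bounded (a : nat -> C) (s : C) :
  is_Cseries a s -> exists B, forall n, (Cmod (a n) <= B)%R.
Proof.
  intros H.
  destruct (filterlim_bounded (V := C_NormedModule)
    (sum_n (G := C_NormedModule) a) (ex_intro _ s H)) as [B HB].
  exists (B + B)%R; intros [|n].
  - specialize (HB O); rewrite sum_O in HB.
    change (Cmod (a O) <= B)%R in HB.
    pose proof (Cmod_ge_0 (a O)); lra.
  - pose proof (HB n) as H0; pose proof (HB (S n)) as H1.
    rewrite sum_Sn in H1.
    set (S0 := sum_n _ n) in *.
    change (Cmod S0 <= B)%R in H0.
    change (Cmod (S0 + a (S n)) <= B)%R in H1.
    replace (a (S n)) with ((S0 + a (S n)) - S0)
      by (generalize (a (S n)); intros; unfold Cminus; ring).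
    eapply Rle_trans; [apply Cmod_triangle_minus|lra].
Qed.

Definition disk_series (c : nat -> C) (h : C -> C) : Prop :=
  forall z, unit_disk z -> is_Cseries (fun n => c n * z ^ n) (h z).

(** Convergence at the midpoint of [rho] and 1 bounds the terms there. Passing to moduli makes the
    real theory of [CV_radius] and [PS_derive] available for the complex series. *)
Lemma disk_series_CV_radius (c : nat -> C) (h : C -> C) (rho : R) :
  disk_series c h -> (0 <= rho < 1)%R ->
  Rbar_lt (Rabs rho) (CV_radius (fun n => Cmod (c n))).
Proof.
  intros H Hrho.
  rewrite Rabs_pos_eq by lra.
  apply Rbar_lt_le_trans with ((rho + 1) / 2)%R; [simpl; lra|].
  apply CV_radius_bounded.
  destruct (is_Cseries_terms_bounded _ _ (H (RtoC ((rho + 1) / 2)%R) ltac:(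
    unfold unit_disk; rewrite Cmod_R, Rabs_pos_eq; lra))) as [B HB].
  exists B; intros n.
  specialize (HB n).
  rewrite Cmod_mult, Cmod_pow, Cmod_R, Rabs_pos_eq in HB by lra.
  rewrite Rabs_pos_eq; [exact HB|].
  apply Rmult_le_pos; [apply Cmod_ge_0|apply pow_le; lra].
Qed.

Lemma ex_series_disk_series_derive (c : nat -> C) (h : C -> C) (rho : R) :
  disk_series c h -> (0 <= rho < 1)%R ->
  ex_series (fun n => INR (S n) * Cmod (c (S n)) * rho ^ n)%R.
Proof.
  intros H Hrho.
  apply ex_series_Rabs, (CV_disk_inside (PS_derive (fun n => Cmod (c n)))).
  rewrite CV_radius_derive; eapply disk_series_CV_radius; eassumption.
Qed.

Lemma ex_series_disk_series_derive2 (c : nat -> C) (h : C -> C) (rho : R) :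
  disk_series c h -> (0 <= rho < 1)%R ->
  ex_series (fun n =>
    INR (S n) * (INR (S (S n)) * Cmod (c (S (S n)))) * rho ^ n)%R.
Proof.
  intros H Hrho.
  apply ex_series_Rabs,
    (CV_disk_inside (PS_derive (PS_derive (fun n => Cmod (c n))))).
  rewrite !CV_radius_derive; eapply disk_series_CV_radius; eassumption.
Qed.

Lemma ex_Cseries_of_bound (a : nat -> C) (b : nat -> R) :
  (forall n, (Cmod (a n) <= b n)%R) -> ex_series b ->
  exists s : C, is_Cseries a s.
Proof.
  intros Hab Hb.
  apply (ex_series_le (V := C_CompleteNormedModule) a b Hab Hb).
Qed.

Lemma disk_series_remainder (c : nat -> C) (h : C -> C) (z : C) (rho : R) (l : C) :
  disk_series c h -> (Cmod z <= rho < 1)%R ->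
  is_Cseries (fun n => INR (S n) * c (S n) * z ^ n) l ->
  exists B, forall w, (Cmod w <= rho)%R ->
    (Cmod (h w - h z - (w - z) * l) <= B * Cmod (w - z) ^ 2)%R.
Proof.
  intros H Hz Hl.
  pose proof (Cmod_ge_0 z) as Hz0.
  pose proof (ex_series_disk_series_derive2 c h rho H ltac:(lra)) as Hex.
  exists (Series (fun n => INR (S n) * (INR (S (S n)) * Cmod (c (S (S n))))
                           * rho ^ n)%R).
  intros w Hw.
  assert (Hs : is_Cseries (fun n => c n * w ^ n - c n * z ^ n) (h w - h z))
    by (apply is_Cseries_minus; apply H; unfold unit_disk; lra).
  apply is_Cseries_tail in Hs.
  pose proof (is_Cseries_minus _ _ _ _ Hs (is_Cseries_scal (w - z) _ _ Hl))
    as Hr.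
  (* The term of index 0 is now [c 1 (w - z) - (w - z) c 1 = 0]; without it only powers of exponent
     at least 2 remain. *)
  apply is_Cseries_tail in Hr.
  match type of Hr with is_series _ ?t =>
    replace t with (h w - h z - (w - z) * l) in Hr by (simpl; ring) end.
  rewrite <- Series_scal_r.
  eapply is_Cseries_bound_Series; [exact Hr| |].
  - apply ex_series_scal_r, Hex.
  - intros n; cbv beta.
    match goal with |- (Cmod ?t <= _)%R =>
      replace t with (c (S (S n)) * (w ^ S (S n) - z ^ S (S n)
        - INR (S (S n)) * z ^ S n * (w - z))) by ring end.
    rewrite Cmod_mult.
    eapply Rle_trans.
    + apply Rmult_le_compat_l; [apply Cmod_ge_0|].
      apply Cpow_taylor2_bound; [exact Hw|apply Hz].
    + generalize (INR (S n)) (INR (S (S n))) (pos_INR (S n)) (pos_INR (S (S n))).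
      intros x y Hx Hy.
      assert (0 <= Cmod (c (S (S n))) * (y * x / 2 * rho ^ n
               * Cmod (w - z) ^ 2))%R; [|lra].
      apply Rmult_le_pos; [apply Cmod_ge_0|].
      apply Rmult_le_pos; [|apply pow_le, Cmod_ge_0].
      apply Rmult_le_pos; [|apply pow_le; lra].
      nra.
Qed.

Lemma is_derive_disk_series (c : nat -> C) (h : C -> C) (z l : C) :
  disk_series c h -> unit_disk z ->
  is_Cseries (fun n => INR (S n) * c (S n) * z ^ n) l ->
  is_derive (K := C_AbsRing) (V := C_NormedModule) h z l.
Proof.
  unfold unit_disk; intros H Hz Hl.
  pose proof (Cmod_ge_0 z) as Hz0.
  destruct (disk_series_remainder c h z ((Cmod z + 1) / 2) l H ltac:(lra) Hl)
    as [B HB].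
  split; [apply is_linear_scal_l|].
  intros x Hx.
  apply (is_filter_lim_locally_unique
           (V := AbsRing_NormedModule C_AbsRing) z x) in Hx; subst x.
  intros eps.
  assert (HB0 : (0 < Rabs B + 1)%R) by (pose proof (Rabs_pos B); lra).
  assert (He : (0 < Rmin ((1 - Cmod z) / 2) (eps / (Rabs B + 1)))%R).
  { apply Rmin_glb_lt; [lra|].
    apply Rdiv_lt_0_compat; [apply cond_pos|exact HB0]. }
  exists (mkposreal _ He).
  intros y Hy.
  change (Cmod (y - z) < Rmin ((1 - Cmod z) / 2) (eps / (Rabs B + 1)))%R in Hy.
  change (Cmod (h y - h z - (y - z) * l) <= eps * Cmod (y - z))%R.
  pose proof (Rmin_l ((1 - Cmod z) / 2) (eps / (Rabs B + 1))).
  pose proof (Rmin_r ((1 - Cmod z) / 2) (eps / (Rabs B + 1))).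
  eapply Rle_trans; [apply HB|].
  - pose proof (Cmod_minus_lower y z); lra.
  - pose proof (Rle_abs B).
    pose proof (Cmod_ge_0 (y - z)) as Hd.
    assert (B * Cmod (y - z) <= eps)%R.
    { apply Rle_trans with ((Rabs B + 1) * Cmod (y - z))%R; [nra|].
      apply Rle_trans with ((Rabs B + 1) * (eps / (Rabs B + 1)))%R.
      - apply Rmult_le_compat_l; lra.
      - right; field; lra. }
    simpl (_ ^ 2)%R; rewrite Rmult_1_r, <- Rmult_assoc.
    apply Rmult_le_compat_r; assumption.
Qed.

(** Since the conclusion is again a [disk_series], the lemma can be iterated to reach
    [C_derive (C_derive h)]. *)
Lemma disk_series_C_derive (c : nat -> C) (h : C -> C) :
  disk_series c h ->
  disk_series (fun n => INR (S n) * c (S n)) (C_derive h).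
Proof.
  intros H z Hz.
  destruct (ex_Cseries_of_bound (fun n => INR (S n) * c (S n) * z ^ n)
     (fun n => INR (S n) * Cmod (c (S n)) * Cmod z ^ n)%R) as [l Hl].
  - intros n.
    rewrite !Cmod_mult, Cmod_R, Cmod_pow, Rabs_pos_eq by apply pos_INR.
    lra.
  - apply (ex_series_disk_series_derive c h); [exact H|].
    split; [apply Cmod_ge_0|exact Hz].
  - rewrite (is_C_derive_unique h z l); [exact Hl|].
    apply (is_derive_disk_series c); assumption.
Qed.

(** * Caratheodory's coefficient inequality *)

Fixpoint Csum (n : nat) (F : nat -> C) : C :=
  match n with
  | O => 0
  | S n' => Csum n' F + F n'
  end.

Lemma Csum_ext (n : nat) (F G : nat -> C) :
  (forall j, F j = G j) -> Csum n F = Csum n G.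
Proof.
  intros H; induction n as [|n IH]; simpl; [reflexivity|].
  rewrite IH, H; reflexivity.
Qed.

Lemma Csum_plus (n : nat) (F G : nat -> C) :
  Csum n (fun j => F j + G j) = Csum n F + Csum n G.
Proof.
  induction n as [|n IH]; simpl; [|rewrite IH]; ring.
Qed.

Lemma Csum_scal (n : nat) (c : C) (F : nat -> C) :
  Csum n (fun j => c * F j) = c * Csum n F.
Proof.
  induction n as [|n IH]; simpl; [|rewrite IH]; ring.
Qed.

Lemma Csum_bound (n : nat) (F : nat -> C) (B : R) :
  (forall j, (Cmod (F j) <= B)%R) -> (Cmod (Csum n F) <= INR n * B)%R.
Proof.
  intros H; induction n as [|n IH].
  { simpl; rewrite Cmod_0; lra. }
  rewrite S_INR; simpl Csum.
  eapply Rle_trans; [apply Cmod_triangle|].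
  specialize (H n); lra.
Qed.

Lemma Csum_Re_nonneg (n : nat) (F : nat -> C) :
  (forall j, (0 <= Re (F j))%R) -> (0 <= Re (Csum n F))%R.
Proof.
  intros H; induction n as [|n IH]; simpl; [lra|].
  specialize (H n); unfold Re in *; simpl; lra.
Qed.

Lemma is_Cseries_Csum (n : nat) (a : nat -> nat -> C) (s : nat -> C) :
  (forall j, is_Cseries (a j) (s j)) ->
  is_Cseries (fun m => Csum n (fun j => a j m)) (Csum n s).
Proof.
  intros H; induction n as [|n IH]; simpl.
  - apply is_Cseries_ext with (fun m => if Nat.eq_dec m O then RtoC 0 else RtoC 0);
      [intros m; destruct Nat.eq_dec; reflexivity|].
    apply is_Cseries_single.
  - apply is_Cseries_plus; [exact IH|apply H].
Qed.

Lemma Csum_geometric (z : C) (n : nat) :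
  (1 - z) * Csum n (fun j => z ^ j) = 1 - z ^ n.
Proof.
  induction n as [|n IH]; simpl; [ring|].
  rewrite Cmult_plus_distr_l, IH; ring.
Qed.

Lemma Csum_unity_root (z : C) (n : nat) :
  z ^ n = 1 -> z <> 1 -> Csum n (fun j => z ^ j) = 0.
Proof.
  intros Hn Hz.
  pose proof (Csum_geometric z n) as H.
  rewrite Hn in H.
  replace (Csum n (fun j => z ^ j))
    with (/ (1 - z) * ((1 - z) * Csum n (fun j => z ^ j))).
  - rewrite H; unfold Cminus; rewrite Cplus_opp_r; ring.
  - field.
    intros E; apply Hz.
    replace z with (1 - (1 - z)) by ring.
    rewrite E; ring.
Qed.

Lemma Csum_one (n : nat) : Csum n (fun j => 1 ^ j) = INR n.
Proof.
  induction n as [|n IH]; [reflexivity|].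
  rewrite S_INR, RtoC_plus; simpl Csum.
  rewrite IH, Cpow_1_l; reflexivity.
Qed.

(** * Averages over roots of unity *)

Definition primitive_root (w : C) (N : nat) : Prop :=
  Cmod w = 1%R /\ w ^ N = 1 /\ forall i, (0 < i < N)%nat -> w ^ i <> 1.

Lemma exists_primitive_root (N : nat) :
  (0 < N)%nat -> exists w, primitive_root w N.
Proof.
  intros HN.
  set (t := (2 * PI / INR N)%R).
  assert (HN' : (0 < INR N)%R) by (apply lt_0_INR, HN).
  pose proof PI_RGT_0 as Hpi.
  set (w := (cos t, sin t) : C).
  assert (Hpow : forall n, w ^ n = (cos (INR n * t), sin (INR n * t))).
  { induction n as [|n IH].
    - simpl; rewrite Rmult_0_l, cos_0, sin_0; reflexivity.
    - rewrite Cpow_S, IH, S_INR, Rmult_plus_distr_r, Rmult_1_l, cos_plus, sin_plus.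
      unfold w, Cmult; simpl; f_equal; ring. }
  exists w; repeat split.
  - pose proof (Cmod_ge_0 w) as H0.
    pose proof (Cmod_sq w) as H1.
    unfold w, Re, Im in H1; simpl in H1.
    pose proof (sin2_cos2 t) as H2; unfold Rsqr in H2.
    fold w in H1; nra.
  - rewrite Hpow.
    replace (INR N * t)%R with (2 * PI)%R by (unfold t; field; lra).
    rewrite cos_2PI, sin_2PI; reflexivity.
  - intros i [Hi0 HiN] E.
    rewrite Hpow in E; apply (f_equal fst) in E; simpl in E.
    assert (Hi : (0 < INR i)%R) by (apply lt_0_INR, Hi0).
    assert (HiN' : (INR i < INR N)%R) by (apply lt_INR, HiN).
    (* By [cos (2 x) = 1 - 2 sin^2 x], a cosine equal to 1 would force [sin x = 0], whereas
       [x = i PI / N] lies strictly between 0 and [PI]. *)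
    replace (INR i * t)%R with (2 * (INR i * PI / INR N))%R in E
      by (unfold t; field; lra).
    rewrite cos_2a_sin in E.
    assert (0 < sin (INR i * PI / INR N))%R; [|nra].
    apply sin_gt_0.
    + apply Rdiv_lt_0_compat; nra.
    + apply (Rmult_lt_reg_r (INR N)); [exact HN'|].
      unfold Rdiv; rewrite Rmult_assoc, Rinv_l, Rmult_1_r by lra; nra.
Qed.

Lemma Cconj_mult_self (w : C) : Cmod w = 1%R -> Cconj w * w = 1.
Proof.
  intros H.
  rewrite Cmult_comm, <- Cmod2_conj, H; simpl; rewrite !Rmult_1_r; reflexivity.
Qed.

Lemma primitive_root_inj (w : C) (N i j : nat) :
  primitive_root w N -> (i < N)%nat -> (j < N)%nat -> w ^ i = w ^ j -> i = j.
Proof.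
  intros [H1 [_ Hp]].
  assert (main : forall i j, (i < j)%nat -> (j < N)%nat -> w ^ i <> w ^ j).
  { clear i j; intros i j Hij Hj E.
    apply (Hp (j - i)%nat); [lia|].
    replace (w ^ j) with (w ^ i * w ^ (j - i)) in E
      by (rewrite <- Cpow_add_r; f_equal; lia).
    apply (f_equal (fun x => Cconj (w ^ i) * x)) in E.
    rewrite Cmult_assoc, !Cconj_mult_self in E
      by (rewrite Cmod_pow, H1, pow1; reflexivity).
    rewrite Cmult_1_l in E; symmetry; exact E. }
  intros Hi Hj E.
  destruct (Nat.lt_trichotomy i j) as [H|[H|H]]; [|exact H|]; exfalso.
  - apply (main i j); assumption.
  - apply (main j i); [exact H|exact Hi|symmetry; exact E].
Qed.

(* Averaging over [N]-th roots of unity against this nonnegative weight replaces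
   the Poisson-type integral in Caratheodory's inequality: up to aliasing from
   the terms of order at least [N - k], only orders [0] and [k] survive. *)
Definition fejer_weight (u w : C) (k j : nat) : R := (1 + Re (u * (w ^ j) ^ k))%R.

Lemma fejer_weight_range (u w : C) (k j : nat) :
  Cmod u = 1%R -> Cmod w = 1%R -> (0 <= fejer_weight u w k j <= 2)%R.
Proof.
  intros Hu Hw; unfold fejer_weight.
  pose proof (re_le_Cmod (u * (w ^ j) ^ k)) as H.
  rewrite Cmod_mult, !Cmod_pow, Hu, Hw, !pow1, Rmult_1_r in H.
  apply Rabs_le_between in H; lra.
Qed.

Lemma Cpow_comm (w : C) (i j : nat) : (w ^ i) ^ j = (w ^ j) ^ i.
Proof.
  rewrite <- !Cpow_mult_r; f_equal; lia.
Qed.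

(** Writing [Re x = (x + conj x) / 2] turns the weighted sum into three geometric sums, each of
    which vanishes unless its ratio is 1. *)
Lemma Csum_fejer (u w : C) (N k m : nat) :
  Csum N (fun j => fejer_weight u w k j * (w ^ j) ^ m)
  = Csum N (fun j => (w ^ m) ^ j) + u / 2 * Csum N (fun j => (w ^ k * w ^ m) ^ j)
    + Cconj u / 2 * Csum N (fun j => (Cconj (w ^ k) * w ^ m) ^ j).
Proof.
  rewrite <- !Csum_scal, <- !Csum_plus.
  apply Csum_ext; intros j.
  unfold fejer_weight.
  rewrite RtoC_plus, re_alt, Cmult_conj, !Cpow_mult_l, <- !Cpow_conj.
  rewrite !(Cpow_comm w _ j).
  field.
Qed.

Lemma Csum_fejer_bound (u w : C) (N k m : nat) :
  Cmod u = 1%R -> Cmod w = 1%R ->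
  (Cmod (Csum N (fun j => fejer_weight u w k j * (w ^ j) ^ m)%C) <= INR N * 2)%R.
Proof.
  intros Hu Hw.
  apply Csum_bound; intros j.
  pose proof (fejer_weight_range u w k j Hu Hw).
  rewrite Cmod_mult, Cmod_R, Rabs_pos_eq, !Cmod_pow, Hw, !pow1 by lra; lra.
Qed.

Lemma Csum_primitive_root (w : C) (N i : nat) :
  primitive_root w N -> (0 < i < N)%nat -> Csum N (fun j => (w ^ i) ^ j) = 0.
Proof.
  intros [_ [HN Hp]] Hi.
  apply Csum_unity_root; [|apply Hp, Hi].
  rewrite Cpow_comm, HN; apply Cpow_1_l.
Qed.

Lemma Csum_primitive_root_conj (w : C) (N k m : nat) :
  primitive_root w N -> (k < N)%nat -> (m < N)%nat -> m <> k ->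
  Csum N (fun j => (Cconj (w ^ k) * w ^ m) ^ j) = 0.
Proof.
  intros Hw Hk Hm Hne.
  pose proof Hw as [H1 [HN _]].
  apply Csum_unity_root.
  - rewrite Cpow_mult_l, <- Cpow_conj, !(Cpow_comm w _ N), HN, !Cpow_1_l.
    replace (Cconj 1) with (RtoC 1)
      by (unfold Cconj; simpl; rewrite Ropp_0; reflexivity).
    ring.
  - intros E; apply Hne; symmetry.
    apply (primitive_root_inj w N); try assumption.
    rewrite <- (Cmult_1_r (w ^ k)), <- E, Cmult_assoc, (Cmult_comm (w ^ k)).
    rewrite Cconj_mult_self by (rewrite Cmod_pow, H1, pow1; reflexivity).
    ring.
Qed.

Lemma Csum_fejer_zero (u w : C) (N k m : nat) :
  primitive_root w N -> (0 < m)%nat -> (m + k < N)%nat -> m <> k ->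
  Csum N (fun j => fejer_weight u w k j * (w ^ j) ^ m) = 0.
Proof.
  intros Hw Hm HmN Hne.
  rewrite Csum_fejer, (Csum_primitive_root w N m Hw), <- Cpow_add_r by lia.
  rewrite (Csum_primitive_root w N (k + m) Hw) by lia.
  rewrite (Csum_primitive_root_conj w N k m Hw) by lia.
  ring.
Qed.

Lemma Csum_fejer_0 (u w : C) (N k : nat) :
  primitive_root w N -> (0 < k < N)%nat ->
  Csum N (fun j => fejer_weight u w k j * (w ^ j) ^ 0) = INR N.
Proof.
  intros Hw Hk.
  rewrite Csum_fejer, <- Cpow_add_r, Nat.add_0_r.
  rewrite (Csum_primitive_root w N k Hw), (Csum_primitive_root_conj w N k 0 Hw)
    by lia.
  change (w ^ 0) with (RtoC 1); rewrite Csum_one; ring.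
Qed.

(** Only the conjugate ratio equals 1; [2 * k < N] prevents [w ^ (k + k)] from being 1 as well. *)
Lemma Csum_fejer_k (u w : C) (N k : nat) :
  primitive_root w N -> (0 < k)%nat -> (2 * k < N)%nat ->
  Csum N (fun j => fejer_weight u w k j * (w ^ j) ^ k) = Cconj u / 2 * INR N.
Proof.
  intros Hw Hk HN.
  rewrite Csum_fejer, <- Cpow_add_r, (Csum_primitive_root w N k Hw) by lia.
  rewrite (Csum_primitive_root w N (k + k) Hw) by lia.
  destruct Hw as [H1 _].
  rewrite Cconj_mult_self by (rewrite Cmod_pow, H1, pow1; reflexivity).
  rewrite Csum_one; ring.
Qed.

(** The right-hand side bounds from above a weighted average of the nonnegative values [Re (P z)]
    over equally spaced points of [|z| = rho]. The last term is the aliasing error; its 2 is the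
    maximum of the weight, and it tends to 0 in [n] for fixed [rho]. *)
Lemma Re_disk_series_lower (p : nat -> C) (P : C -> C) (k n : nat) (rho : R) (u : C) :
  disk_series p P -> (forall z, unit_disk z -> (0 <= Re (P z))%R) ->
  (0 <= rho < 1)%R -> Cmod u = 1%R -> (0 < k < n)%nat ->
  (0 <= Re (p O) + Re (Cconj u * p k) * rho ^ k / 2
        + 2 / INR n * Series (fun m => INR m * Cmod (p m) * rho ^ m))%R.
Proof.
  intros HP Hpos Hrho Hu Hkn.
  (* With this [N], every order [m < n] satisfies [m + k < N], and [k < n] gives [2 * k < N], so
     aliasing starts only at order [n]. *)
  set (N := (n + k)%nat).
  destruct (exists_primitive_root N ltac:(lia)) as [w Hw].
  pose proof Hw as [Hw1 _].
  assert (HnR : (0 < INR n)%R) by (apply lt_0_INR; lia).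
  assert (HNR : (0 < INR N)%R) by (apply lt_0_INR; lia).
  assert (Hex : ex_series (fun m => INR m * Cmod (p m) * rho ^ m)%R).
  { apply (ex_series_incr_1 (V := R_NormedModule)).
    apply ex_series_ext with
      (fun m => rho * (INR (S m) * Cmod (p (S m)) * rho ^ m))%R.
    - intros m; simpl (rho ^ S m)%R.
      match goal with |- ?x = ?y => change (@eq R x y) end; ring.
    - apply (ex_series_scal_l (V := R_NormedModule)).
      apply (ex_series_disk_series_derive p P rho HP Hrho). }
  set (pt := fun j => rho * w ^ j).
  assert (Hpt : forall j, unit_disk (pt j)).
  { intros j; unfold unit_disk, pt.
    rewrite Cmod_mult, Cmod_pow, Hw1, pow1, Cmod_R, Rabs_pos_eq; lra. }
  set (T := Csum N (fun j => fejer_weight u w k j * P (pt j))).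
  assert (HT : is_Cseries (fun m => p m * rho ^ m
       * Csum N (fun j => fejer_weight u w k j * (w ^ j) ^ m)) T).
  { apply is_Cseries_ext with
      (fun m => Csum N (fun j => fejer_weight u w k j * (p m * pt j ^ m))).
    - intros m; rewrite <- Csum_scal; apply Csum_ext; intros j.
      unfold pt; rewrite Cpow_mult_l; ring.
    - apply is_Cseries_Csum; intros j.
      apply is_Cseries_scal, HP, Hpt. }
  set (c0 := INR N * p O).
  set (ck := p k * rho ^ k * (Cconj u / 2 * INR N)).
  (* The aliased terms have order [m >= n], so inserting the factor
     [m / n >= 1] bounds them by a fixed convergent series divided by [n]. *)
  assert (Hrem : (Cmod (T - c0 - ck) <= INR N * 2 / INR n
     * Series (fun m => INR m * Cmod (p m) * rho ^ m))%R).
  { rewrite <- Series_scal_l.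
    eapply is_Cseries_bound_Series.
    - apply is_Cseries_minus; [apply is_Cseries_minus; [exact HT|]|].
      + apply (is_Cseries_single O c0).
      + apply (is_Cseries_single k ck).
    - apply (ex_series_scal_l (V := R_NormedModule)), Hex.
    - intros m; cbv beta.
      assert (Hm0 : (0 <= INR m * Cmod (p m) * rho ^ m)%R).
      { apply Rmult_le_pos; [|apply pow_le; lra].
        apply Rmult_le_pos; [apply pos_INR|apply Cmod_ge_0]. }
      assert (Hz : (Cmod 0 <= INR N * 2 / INR n * (INR m * Cmod (p m) * rho ^ m))%R).
      { rewrite Cmod_0; apply Rmult_le_pos; [|exact Hm0].
        apply Rlt_le, Rdiv_lt_0_compat; lra. }
      destruct (Nat.eq_dec m 0) as [Em|Em], (Nat.eq_dec m k) as [Ek|Ek]; try lia.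
      + subst m; rewrite Csum_fejer_0 by (assumption || lia).
        replace (_ - _ - _) with (RtoC 0); [exact Hz|].
        unfold c0; simpl; ring.
      + subst m; rewrite Csum_fejer_k by (assumption || lia).
        replace (_ - _ - _) with (RtoC 0); [exact Hz|].
        unfold ck; ring.
      + destruct (Compare_dec.le_lt_dec n m) as [Hnm|Hnm].
        * replace (_ - _ - _) with (p m * rho ^ m
             * Csum N (fun j => fejer_weight u w k j * (w ^ j) ^ m)) by ring.
          rewrite !Cmod_mult, Cmod_pow, Cmod_R, (Rabs_pos_eq rho) by lra.
          pose proof (Csum_fejer_bound u w N k m Hu Hw1) as Hb.
          assert (H0 : (0 <= Cmod (p m) * rho ^ m)%R)
            by (apply Rmult_le_pos; [apply Cmod_ge_0|apply pow_le; lra]).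
          apply (Rmult_le_compat_l _ _ _ H0) in Hb.
          eapply Rle_trans; [exact Hb|].
          assert (Hr : (1 <= INR m / INR n)%R).
          { apply (Rmult_le_reg_r (INR n)); [exact HnR|].
            unfold Rdiv; rewrite Rmult_assoc, Rinv_l, Rmult_1_l, Rmult_1_r by lra.
            apply le_INR, Hnm. }
          assert (H2 : (0 <= Cmod (p m) * rho ^ m * (INR N * 2))%R)
            by (apply Rmult_le_pos; lra).
          apply (Rmult_le_compat_l _ _ _ H2) in Hr.
          eapply Rle_trans; [|eapply Rle_trans; [exact Hr|]].
          -- right; ring.
          -- right; field; lra.
        * rewrite Csum_fejer_zero by (assumption || lia).
          replace (_ - _ - _) with (RtoC 0) by ring.
          exact Hz. }
  assert (HTpos : (0 <= Re T)%R).
  { apply Csum_Re_nonneg; intros j.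
    rewrite re_scal_l.
    apply Rmult_le_pos; [apply fejer_weight_range; assumption|].
    apply Hpos, Hpt. }
  assert (HRe : (Re T <= Re c0 + Re ck + Cmod (T - c0 - ck))%R).
  { pose proof (Re_le_Cmod (T - c0 - ck)) as H.
    unfold Re in *; simpl in H |- *; lra. }
  assert (E0 : Re c0 = (INR N * Re (p O))%R) by apply re_scal_l.
  assert (Ek : Re ck = (INR N * (Re (Cconj u * p k) * rho ^ k / 2))%R).
  { replace ck with (RtoC (INR N * (rho ^ k / 2)) * (Cconj u * p k)).
    - rewrite re_scal_l; field.
    - unfold ck.
      rewrite RtoC_mult, RtoC_div, RtoC_pow by lra.
      field. }
  rewrite E0, Ek in HRe.
  set (A := (Re (Cconj u * p k) * rho ^ k / 2)%R) in *.
  set (Q := Series _) in *.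
  apply (Rmult_le_reg_l (INR N)); [exact HNR|].
  rewrite Rmult_0_r.
  replace (INR N * (Re (p O) + A + 2 / INR n * Q))%R
    with (INR N * Re (p O) + INR N * A + INR N * 2 / INR n * Q)%R by (field; lra).
  lra.
Qed.

Lemma nonneg_of_arbitrarily_small (x B : R) (k : nat) :
  (forall n, (k < n)%nat -> 0 <= x + 2 / INR n * B)%R -> (0 <= x)%R.
Proof.
  intros H.
  apply Rnot_lt_le; intros Hx.
  destruct (INR_archimed (- x) (2 * Rabs B) ltac:(lra)) as [n Hn].
  set (m := S (n + k)).
  assert (Hm : (0 < INR m)%R) by (apply lt_0_INR; lia).
  specialize (H m ltac:(lia)).
  assert (Hnm : (INR n <= INR m)%R) by (apply le_INR; lia).
  pose proof (Rle_abs B).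
  apply (Rmult_le_compat_l (INR m)) in H; [|lra].
  replace (INR m * (x + 2 / INR m * B))%R with (INR m * x + 2 * B)%R in H
    by (field; lra).
  nra.
Qed.

Lemma exists_unimodular (p : C) : exists u, Cmod u = 1%R /\ u * p = Cmod p.
Proof.
  destruct (Req_dec (Cmod p) 0) as [E|E].
  - exists 1; split; [apply Cmod_1|].
    apply Cmod_eq_0 in E; subst p.
    rewrite Cmod_0; ring.
  - assert (Hp : RtoC (Cmod p) <> 0) by (intros H; apply E, RtoC_inj, H).
    exists (Cconj p / Cmod p); split.
    + rewrite Cmod_div, Cmod_conj, Cmod_R, Rabs_pos_eq
        by (exact Hp || apply Cmod_ge_0).
      field; exact E.
    + replace (Cconj p / Cmod p * p) with (p * Cconj p / Cmod p) by (field; exact Hp).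
      rewrite <- Cmod2_conj, RtoC_pow; field; exact Hp.
Qed.

Lemma bernoulli_minus (e : R) (n : nat) :
  (0 <= e <= 1)%R -> (1 - INR n * e <= (1 - e) ^ n)%R.
Proof.
  intros He; induction n as [|n IH]; [simpl; lra|].
  rewrite S_INR; simpl.
  pose proof (pos_INR n).
  assert (0 <= INR n * (e * e))%R by (apply Rmult_le_pos; nra).
  apply (Rmult_le_compat_l (1 - e)) in IH; lra.
Qed.

(** The unimodular factor is chosen to make the order-[k] contribution equal to [- |p k| rho^k / 2];
    then [n] tends to infinity for fixed [rho], and finally [rho] tends to 1. *)
Lemma caratheodory (p : nat -> C) (P : C -> C) (k : nat) :
  disk_series p P -> (forall z, unit_disk z -> (0 <= Re (P z))%R) ->
  (0 < k)%nat -> (Cmod (p k) <= 2 * Re (p O))%R.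
Proof.
  intros HP Hpos Hk.
  destruct (exists_unimodular (p k)) as [u [Hu Eu]].
  assert (H : forall rho, (0 <= rho < 1)%R ->
    (Cmod (p k) * rho ^ k <= 2 * Re (p O))%R).
  { intros rho Hrho.
    assert (0 <= Re (p O) - Cmod (p k) * rho ^ k / 2)%R; [|lra].
    apply nonneg_of_arbitrarily_small with
      (Series (fun m => INR m * Cmod (p m) * rho ^ m)%R) k.
    intros n Hn.
    pose proof (Re_disk_series_lower p P k n rho (- Cconj u) HP Hpos Hrho
      ltac:(rewrite Cmod_opp, Cmod_conj; exact Hu) (conj Hk Hn)) as H.
    rewrite Copp_conj, Cconj_conj in H.
    replace (- u * p k) with (RtoC (- Cmod (p k))) in H
      by (rewrite RtoC_opp, <- Eu; ring).
    rewrite re_RtoC in H; lra. }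
  apply Rnot_lt_le; intros Hlt.
  set (A := Cmod (p k)) in *.
  pose proof (H 0%R ltac:(lra)) as H0.
  rewrite pow_i, Rmult_0_r in H0 by exact Hk.
  assert (HkR : (1 <= INR k)%R) by (apply (le_INR 1); lia).
  (* For [rho = 1 - d / k], Bernoulli gives [A rho^k >= A (1 - d) = (A + 2 Re (p 0)) / 2], which
     exceeds [2 Re (p 0)] if [A] does. *)
  set (d := ((A - 2 * Re (p O)) / (2 * A))%R).
  assert (Hd : (0 < d <= / 2)%R).
  { unfold d; split; [apply Rdiv_lt_0_compat; lra|].
    apply (Rmult_le_reg_r (2 * A)); [lra|].
    unfold Rdiv; rewrite Rmult_assoc, Rinv_l by lra; lra. }
  assert (Hk0 : (0 < / INR k <= 1)%R).
  { split; [apply Rinv_0_lt_compat; lra|].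
    rewrite <- Rinv_1; apply Rinv_le_contravar; lra. }
  assert (He : (0 < d * / INR k <= / 2)%R) by nra.
  pose proof (H (1 - d * / INR k)%R ltac:(lra)) as H1.
  pose proof (bernoulli_minus (d * / INR k) k ltac:(lra)) as H2.
  replace (INR k * (d * / INR k))%R with d in H2 by (field; lra).
  apply (Rmult_le_compat_l A) in H2; [|lra].
  replace (A * (1 - d))%R with (A - (A - 2 * Re (p O)) / 2)%R in H2
    by (unfold d; field; lra).
  lra.
Qed.

Lemma caratheodory_pair (p q : nat -> C) (P Q : C -> C) (k : nat) :
  disk_series p P -> disk_series q Q ->
  (forall z, unit_disk z -> (Cmod (Q z) <= Re (P z))%R) -> q O = 0 ->
  (0 < k)%nat -> (Cmod (p k) + Cmod (q k) <= 2 * Re (p O))%R.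
Proof.
  intros HP HQ H Hq0 Hk.
  destruct (exists_unimodular (p k)) as [u [Hu Eu]].
  destruct (exists_unimodular (q k)) as [v [Hv Ev]].
  (* Since [p k = conj u |p k|] and [e q k = conj u |q k|], the two coefficients point in the same
     direction and their moduli add; [q 0 = 0] leaves the constant coefficient unchanged. *)
  set (e := Cconj u * v).
  assert (He : Cmod e = 1%R)
    by (unfold e; rewrite Cmod_mult, Cmod_conj, Hu, Hv; ring).
  pose proof (caratheodory (fun n => p n + e * q n) (fun z => P z + e * Q z) k)
    as Hc; cbv beta in Hc.
  rewrite Hq0 in Hc.
  replace (p O + e * 0) with (p O) in Hc by ring.
  replace (Cmod (p k) + Cmod (q k))%R with (Cmod (p k + e * q k)).
  - apply Hc; [|clear Hc|exact Hk].
    + intros z Hz.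
      apply is_Cseries_ext with (fun n => p n * z ^ n + e * (q n * z ^ n));
        [intros n; ring|].
      apply is_Cseries_plus; [apply HP, Hz|apply is_Cseries_scal, HQ, Hz].
    + intros z Hz; specialize (H z Hz).
      pose proof (re_le_Cmod (e * Q z)) as H1.
      rewrite Cmod_mult, He, Rmult_1_l in H1.
      apply Rabs_le_between in H1.
      change (0 <= Re (P z) + Re (e * Q z))%R; lra.
  - replace (p k + e * q k) with (Cconj u * (u * p k + v * q k)).
    + rewrite Cmod_mult, Cmod_conj, Hu, Eu, Ev, <- RtoC_plus, Cmod_R, Rabs_pos_eq.
      * ring.
      * pose proof (Cmod_ge_0 (p k)); pose proof (Cmod_ge_0 (q k)); lra.
    + unfold e; rewrite Cmult_plus_distr_l, Cmult_assoc, Cconj_mult_self by exact Hu.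
      ring.
Qed.

(** * Starlike and convex images of perturbations of the identity *)

(** Banach's theorem on a closed ball that [T] is not assumed to preserve: the first step
    [(1 - q) delta] is just short enough for the geometric series of steps to stay within
    [delta]. *)
Lemma contraction_fixed_point (T : C -> C) (z0 : C) (delta q : R) :
  (0 <= q < 1)%R -> (0 <= delta)%R ->
  (forall z w, (Cmod (z - z0) <= delta)%R -> (Cmod (w - z0) <= delta)%R ->
    (Cmod (T z - T w) <= q * Cmod (z - w))%R) ->
  (Cmod (T z0 - z0) <= (1 - q) * delta)%R ->
  exists z, (Cmod (z - z0) <= delta)%R /\ T z = z.
Proof.
  intros Hq Hd HT H0.
  set (x := fix x n := match n with O => z0 | S n' => T (x n') end).
  assert (Hqn : forall n, (0 <= q ^ n)%R) by (intros n; apply pow_le; lra).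
  assert (Hx : forall n, (Cmod (x n - z0) <= (1 - q ^ n) * delta)%R /\
     (Cmod (x (S n) - x n) <= q ^ n * ((1 - q) * delta))%R).
  { induction n as [|n [IH1 IH2]].
    - split; simpl; [|lra].
      replace (z0 - z0) with (RtoC 0) by ring; rewrite Cmod_0; lra.
    - assert (H1 : (Cmod (x (S n) - z0) <= (1 - q ^ S n) * delta)%R).
      { replace (x (S n) - z0) with ((x (S n) - x n) + (x n - z0)) by ring.
        eapply Rle_trans; [apply Cmod_triangle|].
        simpl (q ^ S n)%R; lra. }
      split; [exact H1|].
      change (x (S (S n))) with (T (x (S n))).
      change (x (S n)) with (T (x n)) at 2.
      pose proof (Hqn n); pose proof (Hqn (S n)).
      eapply Rle_trans; [apply HT; nra|].
      apply (Rmult_le_compat_l q) in IH2; [|lra].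
      simpl (q ^ S n)%R; lra. }
  assert (Hgeom : is_series (fun n => q ^ n * ((1 - q) * delta))%R delta).
  { assert (Hq' : (Rabs q < 1)%R) by (rewrite Rabs_pos_eq; lra).
    pose proof (is_series_scal_r ((1 - q) * delta) _ _ (is_series_geom q Hq'))
      as Hg.
    replace (/ (1 - q) * ((1 - q) * delta))%R with delta in Hg by (field; lra).
    exact Hg. }
  (* The limit of the iterates is obtained as the sum of the telescoping series of their
     increments. *)
  destruct (ex_Cseries_of_bound (fun n => x (S n) - x n) _
     (fun n => proj2 (Hx n)) (ex_intro _ _ Hgeom)) as [s Hs].
  assert (Hsz : (Cmod (z0 + s - z0) <= delta)%R).
  { replace (z0 + s - z0) with s by ring.
    apply (is_Cseries_bound _ _ _ _ Hs Hgeom), Hx. }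
  exists (z0 + s); split; [exact Hsz|].
  assert (Hball : forall n, (Cmod (x n - z0) <= delta)%R).
  { intros n; destruct (Hx n) as [H _]; specialize (Hqn n); nra. }
  assert (Hsum : forall n,
    sum_n (G := C_NormedModule) (fun n => x (S n) - x n) n = x (S n) - z0).
  { induction n as [|n IH]; [apply sum_O|].
    rewrite sum_Sn, IH.
    match goal with |- plus ?a ?b = _ => change (a + b = x (S (S n)) - z0) end.
    ring. }
  assert (Hlim : forall e, (0 < e)%R -> exists n,
    (Cmod (x (S n) - (z0 + s)) < e)%R /\ (Cmod (x (S (S n)) - (z0 + s)) < e)%R).
  { intros e He.
    destruct (Hs (fun y => Cmod (y - s) < e)%R) as [N HN].
    { apply (locally_le_locally_norm (V := C_NormedModule)).
      exists (mkposreal e He); intros y Hy; exact Hy. }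
    exists N; split.
    - specialize (HN N (le_n _)); rewrite Hsum in HN.
      replace (x (S N) - (z0 + s)) with (x (S N) - z0 - s) by ring; exact HN.
    - specialize (HN (S N) ltac:(lia)); rewrite Hsum in HN.
      replace (x (S (S N)) - (z0 + s)) with (x (S (S N)) - z0 - s) by ring.
      exact HN. }
  set (z := z0 + s) in *.
  (* Otherwise two consecutive iterates within [|T z - z| / 2] of [z] would give
     [|T z - z| < |T z - z|] by the triangle inequality. *)
  destruct (Req_dec (Cmod (T z - z)) 0) as [E|E].
  { apply Cmod_eq_0, (proj2 (Ceq_minus _ _)) in E; exact E. }
  exfalso.
  pose proof (Cmod_ge_0 (T z - z)).
  destruct (Hlim (Cmod (T z - z) / 2)%R ltac:(lra)) as [n [H1 H2]].
  pose proof (HT z (x (S n)) Hsz (Hball _)) as H3.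
  rewrite (Cmod_minus_sym z) in H3.
  pose proof (Cmod_triangle (T z - x (S (S n))) (x (S (S n)) - z)) as H4.
  replace (T z - x (S (S n)) + (x (S (S n)) - z)) with (T z - z) in H4 by ring.
  change (T (x (S n))) with (x (S (S n))) in H3.
  pose proof (Cmod_ge_0 (x (S n) - z)); nra.
Qed.

(** The constant [rho / r] is what a coefficient sum at most 1 at radius [r] yields, every term
    carrying at least one factor [rho / r]. *)
Definition near_identity (f : C -> C) (r : R) : Prop :=
  forall rho z w, (rho < r)%R -> (Cmod z <= rho)%R -> (Cmod w <= rho)%R ->
    (Cmod ((f z - z) - (f w - w)) <= rho / r * Cmod (z - w))%R.

(** Preimages of [w] are the fixed points of [z => w - (f z - z)]. The admissible distance depends
    on [rho] but not on [z0], which provides steps of uniform length. *)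
Lemma near_identity_surj (f : C -> C) (r rho rho' : R) (z0 w : C) :
  near_identity f r -> (Cmod z0 <= rho)%R -> (rho < rho' < r)%R ->
  (Cmod (w - f z0) <= (1 - rho' / r) * (rho' - rho))%R ->
  exists z, (Cmod z <= rho')%R /\ f z = w.
Proof.
  intros Hf Hz0 Hrho Hw.
  pose proof (Cmod_ge_0 z0) as Hz00.
  assert (Hball : forall z, (Cmod (z - z0) <= rho' - rho)%R -> (Cmod z <= rho')%R).
  { intros z Hz; pose proof (Cmod_minus_lower z z0); lra. }
  destruct (contraction_fixed_point (fun z => w - (f z - z)) z0 (rho' - rho)
    (rho' / r)) as [z [Hz Ez]].
  - split; [apply Rlt_le, Rdiv_lt_0_compat; lra|].
    apply (Rmult_lt_reg_r r); [lra|].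
    unfold Rdiv; rewrite Rmult_assoc, Rinv_l; lra.
  - lra.
  - intros z z' Hz Hz'; cbv beta.
    replace (w - (f z - z) - (w - (f z' - z')))
      with (- ((f z - z) - (f z' - z'))) by ring.
    rewrite Cmod_opp.
    apply Hf; [lra| |]; apply Hball; assumption.
  - cbv beta; replace (w - (f z0 - z0) - z0) with (w - f z0) by ring; exact Hw.
  - exists z; split; [apply Hball, Hz|].
    replace w with (w - (f z - z) + (f z - z)) by ring.
    rewrite Ez; ring.
Qed.

Lemma near_identity_step_pos (r rho : R) :
  (0 <= rho < r)%R ->
  (0 < (1 - (rho + r) / 2 / r) * ((rho + r) / 2 - rho))%R.
Proof.
  intros H.
  apply Rmult_lt_0_compat; [|lra].
  apply (Rmult_lt_reg_r r); [lra|].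
  replace ((1 - (rho + r) / 2 / r) * r)%R with (r - (rho + r) / 2)%R
    by (field; lra).
  lra.
Qed.

Lemma open_disk_image (f : C -> C) (r : R) :
  near_identity f r -> open (T := C_UniformSpace) (disk_image f r).
Proof.
  intros Hf w [z0 [Hz0 Ew]].
  apply (locally_le_locally_norm (V := C_NormedModule)).
  pose proof (near_identity_step_pos r (Cmod z0)
    (conj (Cmod_ge_0 z0) Hz0)) as He.
  exists (mkposreal _ He); intros y Hy.
  change (Cmod (y - w) < (1 - (Cmod z0 + r) / 2 / r)
     * ((Cmod z0 + r) / 2 - Cmod z0))%R in Hy.
  destruct (near_identity_surj f r (Cmod z0) ((Cmod z0 + r) / 2) z0 y Hf)
    as [z [Hz Ez]].
  - lra.
  - lra.
  - rewrite <- Ew; lra.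
  - exists z; split; [lra|symmetry; exact Ez].
Qed.

(* Continuity method: the preimage can be continued along the segment in
   steps of uniform length, because the a priori bound keeps it inside the
   closed disk of radius [rho]. *)
Lemma segment_lift (f : C -> C) (r rho : R) (z0 w1 : C) :
  near_identity f r -> (Cmod z0 <= rho < r)%R ->
  (forall (t : R) z, (0 <= t <= 1)%R -> (Cmod z < r)%R ->
    f z = (1 - t)%R * f z0 + t * w1 -> (Cmod z <= rho)%R) ->
  forall t : R, (0 <= t <= 1)%R ->
  disk_image f r ((1 - t)%R * f z0 + t * w1).
Proof.
  intros Hf Hz0 Hap.
  pose proof (Cmod_ge_0 z0) as Hz00.
  pose proof (near_identity_step_pos r rho ltac:(lra)) as He.
  set (rho' := ((rho + r) / 2)%R) in *.
  set (e := ((1 - rho' / r) * (rho' - rho))%R) in *.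
  assert (Hrho' : (rho < rho' < r)%R) by (unfold rho'; lra).
  set (L := Cmod (w1 - f z0)).
  assert (HL : (0 <= L)%R) by apply Cmod_ge_0.
  assert (main : forall n (t : R), (0 <= t <= 1)%R -> (t * L <= INR n * e)%R ->
    exists z, (Cmod z <= rho)%R /\ f z = (1 - t)%R * f z0 + t * w1).
  { induction n as [|n IH]; intros t Ht HtL.
    - exists z0; split; [lra|].
      assert (HtL0 : (Cmod (t * (w1 - f z0)) = 0)%R).
      { rewrite Cmod_mult, Cmod_R, Rabs_pos_eq by lra.
        fold L; simpl in HtL.
        assert (0 <= t * L)%R by (apply Rmult_le_pos; lra); lra. }
      apply Cmod_eq_0 in HtL0.
      rewrite RtoC_minus.
      replace ((1 - t) * f z0 + t * w1) with (f z0 + t * (w1 - f z0)) by ring.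
      rewrite HtL0; ring.
    - assert (HnR : (0 < INR (S n))%R) by (apply lt_0_INR; lia).
      pose proof (pos_INR n) as Hn0.
      (* Of [n + 1] equal steps towards [t], the first [n] reach [s], and the last has length
         [t L / (n + 1) <= e]. *)
      set (s := (t * (INR n / INR (S n)))%R).
      assert (Hfrac : (0 <= INR n / INR (S n) <= 1)%R).
      { split.
        - apply Rmult_le_pos; [exact Hn0|apply Rlt_le, Rinv_0_lt_compat, HnR].
        - apply (Rmult_le_reg_r (INR (S n))); [exact HnR|].
          unfold Rdiv; rewrite Rmult_assoc, Rinv_l, S_INR; lra. }
      assert (Hs : (0 <= s <= 1)%R) by (unfold s; nra).
      assert (HsL : (s * L <= INR n * e)%R).
      { replace (s * L)%R with (INR n / INR (S n) * (t * L))%R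
          by (unfold s; ring).
        replace (INR n * e)%R with (INR n / INR (S n) * (INR (S n) * e))%R
          by (field; lra).
        apply Rmult_le_compat_l; lra. }
      destruct (IH s Hs HsL) as [z1 [Hz1 E1]].
      destruct (near_identity_surj f r rho rho' z1
        ((1 - t)%R * f z0 + t * w1) Hf Hz1 Hrho') as [z [Hz Ez]].
      + rewrite E1.
        replace ((1 - t)%R * f z0 + t * w1 - ((1 - s)%R * f z0 + s * w1))
          with ((t - s)%R * (w1 - f z0))
          by (rewrite !RtoC_minus; ring).
        rewrite Cmod_mult, Cmod_R; fold L e.
        assert (Ets : (t - s = t / INR (S n))%R)
          by (unfold s; rewrite S_INR in *; field; lra).
        rewrite Ets, Rabs_pos_eq
          by (apply Rmult_le_pos; [lra|apply Rlt_le, Rinv_0_lt_compat, HnR]).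
        apply (Rmult_le_reg_l (INR (S n))); [exact HnR|].
        replace (INR (S n) * (t / INR (S n) * L))%R with (t * L)%R
          by (field; lra).
        exact HtL.
      + exists z; split; [|exact Ez].
        apply (Hap t); [exact Ht|lra|exact Ez]. }
  intros t Ht.
  destruct (INR_archimed e (t * L) He) as [n Hn].
  destruct (main n t Ht ltac:(lra)) as [z [Hz Ez]].
  exists z; split; [lra|symmetry; exact Ez].
Qed.

(** * Connectedness along segments *)

Lemma segment_open_locally (U : C -> Prop) (w0 w1 : C) (s : R) :
  open (T := C_UniformSpace) U -> U ((1 - s)%R * w0 + s * w1) ->
  exists e, (0 < e)%R /\
    forall t : R, (Rabs (t - s) < e)%R -> U ((1 - t)%R * w0 + t * w1).
Proof.
  intros HU Hs.
  apply HU, (locally_norm_le_locally (V := C_NormedModule)) in Hs.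
  destruct Hs as [d Hd].
  pose proof (Cmod_ge_0 (w1 - w0)) as HL.
  exists (d / (Cmod (w1 - w0) + 1))%R; split.
  { apply Rdiv_lt_0_compat; [apply cond_pos|lra]. }
  intros t Ht; apply Hd.
  match goal with |- ball_norm ?a _ ?b => change (Cmod (b - a) < d)%R end.
  replace (_ - _) with ((t - s)%R * (w1 - w0)) by (rewrite !RtoC_minus; ring).
  rewrite Cmod_mult, Cmod_R.
  apply Rle_lt_trans with (Rabs (t - s) * (Cmod (w1 - w0) + 1))%R.
  - apply Rmult_le_compat_l; [apply Rabs_pos|lra].
  - apply (Rmult_lt_compat_r (Cmod (w1 - w0) + 1)) in Ht; [|lra].
    unfold Rdiv in Ht; rewrite Rmult_assoc, Rinv_l, Rmult_1_r in Ht; lra.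
Qed.

(** Let [s] be the supremum of the parameters in [U]. If its point is in [U], openness forces
    [s = 1], whose point is in [V]; if it is in [V], so are parameters of [U] just below [s]. *)
Lemma segment_connected (Omega U V : C -> Prop) (w0 w1 : C) :
  open (T := C_UniformSpace) U -> open (T := C_UniformSpace) V ->
  (forall w, Omega w -> U w \/ V w) ->
  (forall t : R, (0 <= t <= 1)%R -> Omega ((1 - t)%R * w0 + t * w1)) ->
  U w0 -> V w1 -> exists w, Omega w /\ U w /\ V w.
Proof.
  intros HU HV Hcov Hseg H0 H1.
  set (g := fun t : R => (1 - t)%R * w0 + t * w1).
  assert (g0 : g 0%R = w0) by (unfold g; rewrite Rminus_0_r; ring).
  assert (g1 : g 1%R = w1).
  { unfold g; replace (1 - 1)%R with 0%R by ring; ring. }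
  set (E := fun t => (0 <= t <= 1)%R /\ U (g t)).
  destruct (completeness E) as [s [Hub Hlub]].
  { exists 1%R; intros t [Ht _]; lra. }
  { exists 0%R; split; [lra|rewrite g0; exact H0]. }
  assert (Hs : (0 <= s <= 1)%R).
  { split.
    - apply Hub; split; [lra|rewrite g0; exact H0].
    - apply Hlub; intros t [Ht _]; lra. }
  destruct (Hcov (g s) (Hseg s Hs)) as [Us|Vs].
  - destruct (segment_open_locally U w0 w1 s HU Us) as [e [He HUe]].
    destruct (Req_dec s 1) as [Es|Es].
    + exists (g s); split; [apply Hseg, Hs|split; [exact Us|]].
      rewrite Es, g1; exact H1.
    + exfalso.
      set (t := Rmin 1 (s + e / 2)).
      assert (Ht : (s < t <= s + e / 2)%R /\ (t <= 1)%R).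
      { unfold t; split; [split|].
        - apply Rmin_glb_lt; lra.
        - apply Rmin_r.
        - apply Rmin_l. }
      assert (Et : E t).
      { split; [lra|].
        apply HUe; rewrite Rabs_pos_eq; lra. }
      apply Hub in Et; lra.
  - destruct (segment_open_locally V w0 w1 s HV Vs) as [e [He HVe]].
    assert (Hex : exists t, E t /\ (s - e < t)%R).
    { apply Classical_Prop.NNPP; intros Hn.
      assert (s <= s - e)%R; [|lra].
      apply Hlub; intros t Et.
      apply Rnot_lt_le; intros Hlt; apply Hn; exists t; split; assumption. }
    destruct Hex as [t [[Ht Ut] Hte]].
    assert (t <= s)%R by (apply Hub; split; assumption).
    exists (g t); split; [apply Hseg, Ht|split; [exact Ut|]].
    apply HVe; rewrite Rabs_left1; lra.
Qed.

Lemma starlike_wrt_connected (w0 : C) (Omega : C -> Prop) :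
  starlike_wrt w0 Omega -> connected_set Omega.
Proof.
  intros [H0 Hstar] U V HU HV Hcov [u [Ou Uu]] [v [Ov Vv]].
  destruct (Hcov w0 H0) as [U0|V0].
  - apply (segment_connected Omega U V w0 v); try assumption.
    intros t Ht; apply Hstar; assumption.
  - destruct (segment_connected Omega V U w0 u) as [w [Ow [Vw Uw]]];
      try assumption.
    + intros w Ow; apply or_comm, Hcov, Ow.
    + intros t Ht; apply Hstar; assumption.
    + exists w; split; [|split]; assumption.
Qed.

Lemma Cmod_eq_0_of_contraction (x : C) (q : R) :
  (q < 1)%R -> (Cmod x <= q * Cmod x)%R -> x = 0.
Proof.
  intros Hq H.
  apply Cmod_eq_0.
  pose proof (Cmod_ge_0 x); nra.
Qed.

(** The segment is lifted from [f z0] towards 0. If [f z1 = t f z0] with [|z1| > |z0|], then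
    [(f z1 - z1) - t (f z0 - z0)] is the opposite of [z1 - t z0], so the bound makes [z1 - t z0] no
    larger than a proper fraction of itself. Hence [z1 = t z0], a contradiction. *)
Lemma starlike_in_disk_of_bound (f : C -> C) (r : R) :
  (0 < r)%R -> f 0 = 0 -> near_identity f r ->
  (forall z z1 (t : R), (0 <= t <= 1)%R -> (Cmod z <= Cmod z1 < r)%R ->
    (Cmod ((f z1 - z1) - t * (f z - z))
     <= Cmod z1 / r * Cmod (z1 - t * z))%R) ->
  starlike_in_disk f r.
Proof.
  intros Hr Hf0 Hf Hb.
  assert (Hstar : starlike_wrt 0 (disk_image f r)).
  { split.
    { exists 0; split; [rewrite Cmod_0; exact Hr|symmetry; exact Hf0]. }
    intros w t [z0 [Hz0 Ew]] Ht; subst w.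
    pose proof (Cmod_ge_0 z0).
    assert (Hl : disk_image f r ((1 - (1 - t))%R * f z0 + (1 - t)%R * 0)).
    { apply (segment_lift f r (Cmod z0)); [exact Hf|lra| |lra].
      clear t Ht; intros t z1 Ht Hz1 E.
      apply Rnot_lt_le; intros Hlt.
      assert (E0 : z1 - (1 - t)%R * z0 = 0).
      { apply (Cmod_eq_0_of_contraction _ (Cmod z1 / r)).
        - apply (Rmult_lt_reg_r r); [lra|].
          unfold Rdiv; rewrite Rmult_assoc, Rinv_l; lra.
        - eapply Rle_trans; [|apply (Hb z0 z1 (1 - t)%R); lra].
          rewrite E, <- Cmod_opp; right; f_equal; ring. }
      apply (f_equal Cmod) in E0; rewrite Cmod_0 in E0.
      pose proof (Cmod_minus_lower z1 ((1 - t)%R * z0)) as H1.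
      rewrite Cmod_mult, Cmod_R, Rabs_pos_eq in H1 by lra.
      nra. }
    replace ((1 - t)%R * 0 + t * f z0)
      with ((1 - (1 - t))%R * f z0 + (1 - t)%R * 0); [exact Hl|].
    replace (1 - (1 - t))%R with t by ring; ring. }
  split; [|exact Hstar].
  split; [|split].
  - exists 0; apply Hstar.
  - apply open_disk_image, Hf.
  - eapply starlike_wrt_connected, Hstar.
Qed.

Lemma convex_in_disk_of_bound (f : C -> C) (r : R) :
  (0 < r)%R -> near_identity f r ->
  (forall z z1 z2 (s t : R), (0 <= s)%R -> (0 <= t)%R -> (s + t = 1)%R ->
    (Cmod z1 <= Cmod z)%R -> (Cmod z2 <= Cmod z)%R -> (Cmod z < r)%R ->
    (Cmod ((f z - z) - s * (f z1 - z1) - t * (f z2 - z2))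
     <= Cmod z / r * Cmod (z - s * z1 - t * z2))%R) ->
  convex_in_disk f r.
Proof.
  intros Hr Hf Hb.
  assert (Hconv : forall w0, disk_image f r w0 -> starlike_wrt w0 (disk_image f r)).
  { intros w0 Hw0; split; [exact Hw0|].
    intros w t [z2 [Hz2 Ew]] Ht; destruct Hw0 as [z1 [Hz1 Ew0]]; subst w w0.
    apply (segment_lift f r (Rmax (Cmod z1) (Cmod z2))); [exact Hf| | |exact Ht].
    { split; [apply Rmax_l|apply Rmax_lub_lt; assumption]. }
    clear t Ht; intros t z Ht Hz E.
    apply Rnot_lt_le; intros Hlt.
    pose proof (Rmax_l (Cmod z1) (Cmod z2)) as Hm1.
    pose proof (Rmax_r (Cmod z1) (Cmod z2)) as Hm2.
    set (m := Rmax (Cmod z1) (Cmod z2)) in *.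
    (* The same cancellation makes [z] a convex combination of [z1] and [z2], so [|z|] cannot exceed
       [m]. *)
    assert (E0 : z - (1 - t)%R * z1 - t * z2 = 0).
    { apply (Cmod_eq_0_of_contraction _ (Cmod z / r)).
      - apply (Rmult_lt_reg_r r); [lra|].
        unfold Rdiv; rewrite Rmult_assoc, Rinv_l; lra.
      - eapply Rle_trans; [|apply (Hb z z1 z2 (1 - t)%R t); lra].
        rewrite E, <- Cmod_opp; right; f_equal; ring. }
    apply (f_equal Cmod) in E0; rewrite Cmod_0 in E0.
    pose proof (Cmod_minus_lower (z - (1 - t)%R * z1) (t * z2)) as H1.
    pose proof (Cmod_minus_lower z ((1 - t)%R * z1)) as H2.
    rewrite Cmod_mult, Cmod_R, Rabs_pos_eq in H1, H2 by lra.
    apply (Rmult_le_compat_l (1 - t)) in Hm1; [|lra].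
    apply (Rmult_le_compat_l t) in Hm2; [|lra].
    lra. }
  assert (Hne : disk_image f r (f 0))
    by (exists 0; split; [rewrite Cmod_0; exact Hr|reflexivity]).
  split; [|exact Hconv].
  split; [|split].
  - exists (f 0); exact Hne.
  - apply open_disk_image, Hf.
  - eapply starlike_wrt_connected, Hconv, Hne.
Qed.

(** * Coefficient conditions for starlike and convex images *)

Definition harmonic_tail_expansion (a b : nat -> C) (f : C -> C) : Prop :=
  forall z, unit_disk z ->
    is_Cseries (fun k => a k * z ^ S (S k) + Cconj (b k * z ^ S (S k))) (f z - z).

(** A common form of three estimates: the Lipschitz bound ([s = 1], [t = 0]), the starlike one
    ([t = 0]) and the convex one, with [X] the modulus of the same combination of the points
    themselves. Index [k] belongs to the power [k + 2]. The conjugate part costs nothing, as [s] and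
    [t] are real and moduli ignore conjugation. *)
Lemma tail_combination_bound (a b : nat -> C) (f : C -> C) (W : nat -> R)
  (r rho X s t : R) (z z1 z2 : C) :
  harmonic_tail_expansion a b f ->
  (0 <= rho <= r)%R -> (0 < r)%R -> (0 <= X)%R -> (forall k, 0 <= W k)%R ->
  ex_series (fun k => W k * (Cmod (a k) + Cmod (b k)) * r ^ S k)%R ->
  (Series (fun k => W k * (Cmod (a k) + Cmod (b k)) * r ^ S k) <= 1)%R ->
  unit_disk z -> unit_disk z1 -> unit_disk z2 ->
  (forall k, (Cmod (z ^ S (S k) - s * z1 ^ S (S k) - t * z2 ^ S (S k))
              <= W k * rho ^ S k * X)%R) ->
  (Cmod ((f z - z) - s * (f z1 - z1) - t * (f z2 - z2)) <= rho / r * X)%R.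
Proof.
  intros Hf Hrho Hr HX HW Hex Hle Hz Hz1 Hz2 Hk.
  assert (Hq : (0 <= rho / r)%R)
    by (apply Rmult_le_pos; [lra|apply Rlt_le, Rinv_0_lt_compat, Hr]).
  apply Rle_trans with (rho / r * X
     * Series (fun k => W k * (Cmod (a k) + Cmod (b k)) * r ^ S k))%R.
  2:{ rewrite <- (Rmult_1_r (rho / r * X)) at 2.
      apply Rmult_le_compat_l; [apply Rmult_le_pos; assumption|exact Hle]. }
  rewrite <- Series_scal_l.
  eapply is_Cseries_bound_Series.
  - apply is_Cseries_minus; [apply is_Cseries_minus|].
    + apply Hf, Hz.
    + apply is_Cseries_scal, Hf, Hz1.
    + apply is_Cseries_scal, Hf, Hz2.
  - apply (ex_series_scal_l (V := R_NormedModule)), Hex.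
  - intros k; cbv beta.
    set (D := z ^ S (S k) - s * z1 ^ S (S k) - t * z2 ^ S (S k)).
    replace (_ - _ - _) with (a k * D + Cconj (b k * D)).
    + eapply Rle_trans; [apply Cmod_triangle|].
      rewrite Cmod_conj, !Cmod_mult, <- Rmult_plus_distr_r.
      assert (Hd : (0 <= Cmod (a k) + Cmod (b k))%R)
        by (pose proof (Cmod_ge_0 (a k)); pose proof (Cmod_ge_0 (b k)); lra).
      eapply Rle_trans; [apply Rmult_le_compat_l; [exact Hd|apply Hk]|].
      (* One factor [rho] is kept to produce [rho / r]; the others are enlarged to [r]. *)
      assert (Hp : (rho ^ S k <= rho / r * r ^ S k)%R).
      { simpl; replace (rho / r * (r * r ^ k))%R with (rho * r ^ k)%R
          by (field; lra).
        apply Rmult_le_compat_l; [lra|apply pow_incr, Hrho]. }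
      assert (HdW : (0 <= (Cmod (a k) + Cmod (b k)) * W k * X)%R)
        by (apply Rmult_le_pos; [apply Rmult_le_pos|]; auto).
      apply (Rmult_le_compat_l _ _ _ HdW) in Hp.
      lra.
    + unfold D; rewrite !Cmult_conj, !Cminus_conj, !Cmult_conj.
      assert (HR : forall x : R, Cconj x = x)
        by (intros x; unfold Cconj, RtoC; simpl; rewrite Ropp_0; reflexivity).
      rewrite !HR; ring.
Qed.

Lemma near_identity_of_tail (a b : nat -> C) (f : C -> C) (W : nat -> R) (r : R) :
  harmonic_tail_expansion a b f -> (0 < r < 1)%R ->
  (forall k, INR (S (S k)) <= W k)%R ->
  ex_series (fun k => W k * (Cmod (a k) + Cmod (b k)) * r ^ S k)%R ->
  (Series (fun k => W k * (Cmod (a k) + Cmod (b k)) * r ^ S k) <= 1)%R ->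
  near_identity f r.
Proof.
  intros Hf Hr HW Hex Hle rho z w Hrho Hz Hw.
  pose proof (Cmod_ge_0 z).
  pose proof (tail_combination_bound a b f W r rho (Cmod (z - w)) 1 0 z w w) as H1.
  replace (f z - z - (f w - w)) with (f z - z - 1 * (f w - w) - 0 * (f w - w))
    by ring.
  apply H1; try assumption; try (unfold unit_disk; lra).
  - apply Cmod_ge_0.
  - intros k; pose proof (HW k); pose proof (pos_INR (S (S k))); lra.
  - intros k.
    replace (_ - _ - _) with (z ^ S (S k) - w ^ S (S k)) by ring.
    eapply Rle_trans; [apply Cpow_minus_bound; eassumption|].
    apply Rmult_le_compat_r; [apply Cmod_ge_0|].
    apply Rmult_le_compat_r; [apply pow_le; lra|apply HW].
Qed.

Lemma starlike_of_coefficients (a b : nat -> C) (f : C -> C) (r : R) :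
  harmonic_tail_expansion a b f -> f 0 = 0 -> (0 < r < 1)%R ->
  ex_series (fun k => INR (S (S k)) * (Cmod (a k) + Cmod (b k)) * r ^ S k)%R ->
  (Series (fun k => INR (S (S k)) * (Cmod (a k) + Cmod (b k)) * r ^ S k) <= 1)%R ->
  starlike_in_disk f r.
Proof.
  intros Hf Hf0 Hr Hex Hle.
  apply starlike_in_disk_of_bound; [lra|exact Hf0| |].
  - apply (near_identity_of_tail a b f _ r Hf Hr (fun k => Rle_refl _) Hex Hle).
  - intros z z1 t Ht Hz.
    pose proof (Cmod_ge_0 z).
    replace (f z1 - z1 - t * (f z - z))
      with (f z1 - z1 - t * (f z - z) - 0 * (f z - z)) by ring.
    apply (tail_combination_bound a b f (fun k => INR (S (S k))));
      try assumption; try (unfold unit_disk; lra); try lra.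
    + apply Cmod_ge_0.
    + intros k; apply pos_INR.
    + intros k.
      replace (_ - _ - _) with (z1 ^ S (S k) - t * z ^ S (S k)) by ring.
      apply Cpow_starlike_bound; [exact Ht|apply Hz].
Qed.

Lemma convex_of_coefficients (a b : nat -> C) (f : C -> C) (r : R) :
  harmonic_tail_expansion a b f -> (0 < r < 1)%R ->
  ex_series (fun k => INR (S (S k)) ^ 2 * (Cmod (a k) + Cmod (b k)) * r ^ S k)%R ->
  (Series (fun k => INR (S (S k)) ^ 2 * (Cmod (a k) + Cmod (b k)) * r ^ S k)
   <= 1)%R ->
  convex_in_disk f r.
Proof.
  intros Hf Hr Hex Hle.
  apply convex_in_disk_of_bound; [lra| |].
  - apply (near_identity_of_tail a b f (fun k => INR (S (S k)) ^ 2)%R);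
      try assumption.
    intros k.
    assert (H1 : (1 <= INR (S (S k)))%R) by (apply (le_INR 1); lia).
    revert H1; generalize (INR (S (S k))); intros x Hx; nra.
  - intros z z1 z2 s t Hs Ht Hst Hz1 Hz2 Hz.
    pose proof (Cmod_ge_0 z).
    apply (tail_combination_bound a b f (fun k => INR (S (S k)) ^ 2)%R);
      try assumption; try (unfold unit_disk; lra); try lra.
    + apply Cmod_ge_0.
    + intros k; apply pow_le, pos_INR.
    + intros k; apply Cpow_convex_bound; assumption.
Qed.

(** * Roots of power series with nonnegative coefficients *)

Local Close Scope C_scope.

(** Comparison with the logarithm: [1 + x <= exp x] gives [ln (n + 2) - ln (n + 1) <= 1 / (n + 1)],
    which telescopes. *)
Lemma harmonic_sum_unbounded (A : R) :
  exists N, A <= sum_f_R0 (fun n => / INR (S n)) N.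
Proof.
  assert (Hln : forall N, ln (INR (S (S N))) <= sum_f_R0 (fun n => / INR (S n)) N).
  { assert (Hstep : forall n, ln (INR (S (S n))) <= ln (INR (S n)) + / INR (S n)).
    { intros n.
      assert (Hn : 0 < INR (S n)) by (apply lt_0_INR; lia).
      assert (Hi : 0 < / INR (S n)) by (apply Rinv_0_lt_compat, Hn).
      replace (INR (S (S n))) with (INR (S n) * (1 + / INR (S n)))
        by (rewrite (S_INR (S n)); field; lra).
      rewrite ln_mult by lra.
      apply Rplus_le_compat_l.
      rewrite <- (ln_exp (/ INR (S n))) at 2.
      apply ln_le; [lra|].
      apply Rlt_le, exp_ineq1; lra. }
    induction N as [|N IH].
    - pose proof (Hstep O) as H; simpl (INR 1) in H.
      rewrite ln_1 in H; simpl sum_f_R0; simpl (INR 1); lra.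
    - rewrite tech5.
      pose proof (Hstep (S N)); lra. }
  destruct (INR_archimed 1 (exp A) ltac:(lra)) as [n Hn].
  exists n.
  eapply Rle_trans; [|apply Hln].
  rewrite <- (ln_exp A) at 1.
  apply ln_le; [apply exp_pos|].
  rewrite !S_INR; lra.
Qed.

Lemma Series_partial_le (a : nat -> R) (N : nat) :
  ex_series a -> (forall n, 0 <= a n) -> sum_f_R0 a N <= Series a.
Proof.
  intros Ha Hpos.
  apply sum_incr; [|exact Hpos].
  apply is_series_Reals, Series_correct, Ha.
Qed.

Lemma ex_series_bounded_coefficients (c : nat -> R) (B x : R) :
  (forall n, 0 <= c n <= B) -> 0 <= x < 1 -> ex_series (fun n => c n * x ^ n).
Proof.
  intros Hc Hx.
  apply (ex_series_le (V := R_CompleteNormedModule) _ (fun n => x ^ n * B)).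
  - intros n.
    change (Rabs (c n * x ^ n) <= x ^ n * B).
    assert (0 <= x ^ n) by (apply pow_le; lra).
    specialize (Hc n).
    rewrite Rabs_pos_eq; [nra|apply Rmult_le_pos; lra].
  - apply ex_series_scal_r, ex_series_geom.
    rewrite Rabs_pos_eq; lra.
Qed.

Lemma PSeries_as_Series (c : nat -> R) (x : R) :
  PSeries c x = Series (fun n => c n * x ^ n).
Proof. reflexivity. Qed.

Lemma PSeries_nonneg_strict_mono (c : nat -> R) (B s x : R) :
  (forall n, 0 < c n <= B) -> 0 < s < x -> x < 1 ->
  s * PSeries c s < x * PSeries c x.
Proof.
  intros Hc Hs Hx.
  assert (Hex : ex_series (fun n => c n * x ^ n)).
  { apply (ex_series_bounded_coefficients c B); [|lra].
    intros n; specialize (Hc n); lra. }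
  assert (Hle : PSeries c s <= PSeries c x).
  { apply Series_le; [|exact Hex].
    intros n; specialize (Hc n); split.
    - apply Rmult_le_pos; [lra|apply pow_le; lra].
    - apply Rmult_le_compat_l; [lra|apply pow_incr; lra]. }
  assert (Hpos : 0 < PSeries c x).
  { apply Rlt_le_trans with (c O * x ^ O); [simpl; specialize (Hc O); lra|].
    apply (Series_partial_le (fun n => c n * x ^ n) O Hex).
    intros n; specialize (Hc n).
    apply Rmult_le_pos; [lra|apply pow_le; lra]. }
  apply Rle_lt_trans with (s * PSeries c x); nra.
Qed.

(** The lower bound on [c] makes [x * PSeries c x] at least [- m ln (1 - x)]; the proof uses a
    partial sum instead of the logarithm. *)
Lemma PSeries_unbounded (c : nat -> R) (B m K : R) :
  0 < m -> (forall n, m / INR (S n) <= c n <= B) ->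
  exists x, 0 < x < 1 /\ K < x * PSeries c x.
Proof.
  intros Hm Hc.
  assert (HmS : forall n, 0 < m / INR (S n)).
  { intros n; apply Rdiv_lt_0_compat; [exact Hm|apply lt_0_INR; lia]. }
  destruct (harmonic_sum_unbounded (2 * (Rabs K + 1) / m)) as [N HN].
  set (T := INR (S (S N))).
  assert (HT : 2 <= T) by (apply (le_INR 2); lia).
  assert (HTi : 0 < / T <= / 2).
  { split; [apply Rinv_0_lt_compat; lra|apply Rinv_le_contravar; lra]. }
  (* By Bernoulli, [x ^ (N + 2) >= 1/2] for this [x]; the 2 in the choice of [N] makes up for this
     loss. *)
  set (x := 1 - / T / 2).
  assert (Hx : 0 < x < 1) by (unfold x; lra).
  assert (HxT : / 2 <= x ^ S (S N)).
  { eapply Rle_trans; [|apply (bernoulli_minus (/ T / 2)); lra].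
    fold T; right; field; lra. }
  exists x; split; [exact Hx|].
  assert (Hex : ex_series (fun n => c n * x ^ n)).
  { apply (ex_series_bounded_coefficients c B); [|lra].
    intros n; specialize (Hc n); specialize (HmS n); lra. }
  assert (H1 : sum_f_R0 (fun n => c n * x ^ n) N <= PSeries c x).
  { apply (Series_partial_le (fun n => c n * x ^ n)); [exact Hex|].
    intros n; specialize (Hc n); specialize (HmS n).
    apply Rmult_le_pos; [lra|apply pow_le; lra]. }
  assert (H2 : m * x ^ S N * sum_f_R0 (fun n => / INR (S n)) N
               <= sum_f_R0 (fun n => c n * x ^ n) N).
  { rewrite scal_sum.
    apply sum_Rle; intros n Hn.
    assert (Hxn : x ^ S N <= x ^ n).
    { replace (S N) with (n + (S N - n))%nat by lia.
      rewrite pow_add.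
      assert (x ^ (S N - n) <= 1).
      { rewrite <- (pow1 (S N - n)); apply pow_incr; lra. }
      assert (0 <= x ^ n) by (apply pow_le; lra); nra. }
    specialize (Hc n); specialize (HmS n).
    assert (0 <= x ^ S N) by (apply pow_le; lra).
    replace (/ INR (S n) * (m * x ^ S N)) with (m / INR (S n) * x ^ S N)
      by (unfold Rdiv; ring).
    apply Rmult_le_compat; lra. }
  apply Rlt_le_trans with (x * (m * x ^ S N * sum_f_R0 (fun n => / INR (S n)) N)).
  2:{ apply Rmult_le_compat_l; lra. }
  replace (x * (m * x ^ S N * sum_f_R0 (fun n => / INR (S n)) N))
    with (x ^ S (S N) * (m * sum_f_R0 (fun n => / INR (S n)) N)) by (simpl; ring).
  apply (Rmult_le_compat_l m) in HN; [|lra].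
  replace (m * (2 * (Rabs K + 1) / m)) with (2 * (Rabs K + 1)) in HN
    by (field; lra).
  pose proof (Rle_abs K); pose proof (Rabs_pos K).
  set (Y := m * sum_f_R0 _ N) in *.
  apply Rlt_le_trans with (/ 2 * Y); [lra|].
  apply Rmult_le_compat_r; lra.
Qed.

(** Strict monotonicity of [x * PSeries c x] makes the root found by the intermediate value theorem
    the only one, hence the smallest. *)
Lemma smallest_root_exists (c : nat -> R) (G : R -> R) (B m K : R) :
  0 < m -> 0 < K -> (forall n, m / INR (S n) <= c n <= B) ->
  (forall x, 0 < x < 1 -> G x = x * PSeries c x - K) ->
  exists r, smallest_root_01 G r.
Proof.
  intros Hm HK Hc HG.
  assert (HmS : forall n, 0 < m / INR (S n)).
  { intros n; apply Rdiv_lt_0_compat; [exact Hm|apply lt_0_INR; lia]. }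
  assert (HR : Rbar_le 1 (CV_radius c)).
  { apply CV_radius_bounded; exists B; intros n.
    specialize (Hc n); specialize (HmS n).
    rewrite pow1, Rmult_1_r, Rabs_pos_eq; lra. }
  destruct (PSeries_unbounded c B m K Hm Hc) as [y [Hy HyK]].
  destruct (IVT_interv (fun x => x * PSeries c x - K) 0 y) as [r [Hr Er]].
  - intros x Hx.
    apply continuity_pt_minus; [|apply continuity_pt_const; intros ? ?; reflexivity].
    apply continuity_pt_mult; [apply derivable_continuous_pt, derivable_pt_id|].
    apply PSeries_continuity.
    eapply Rbar_lt_le_trans; [|exact HR].
    rewrite Rabs_pos_eq; simpl; lra.
  - lra.
  - lra.
  - lra.
  - assert (Hr01 : 0 < r < 1).
    { split; [|lra].
      destruct (Req_dec r 0) as [E|E]; [|lra].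
      rewrite E, Rmult_0_l in Er; lra. }
    exists r; split; [exact Hr01|split].
    + rewrite HG by exact Hr01; exact Er.
    + intros s Hs Es.
      apply Rnot_lt_le; intros Hlt.
      rewrite HG in Es by exact Hs.
      assert (s * PSeries c s < r * PSeries c r); [|lra].
      apply (PSeries_nonneg_strict_mono c B); try lra.
      intros n; specialize (Hc n); specialize (HmS n); lra.
Qed.

(** * The equations [G1] and [G2] as power series *)

Lemma pochhammer_pos (a : R) (n : nat) : 0 < a -> 0 < pochhammer a n.
Proof.
  intros Ha; induction n as [|n IH]; simpl; [lra|].
  pose proof (pos_INR n); apply Rmult_lt_0_compat; lra.
Qed.

Lemma pochhammer_shift (a : R) (n : nat) :
  pochhammer (1 + a) n * a = pochhammer a n * (a + INR n).
Proof.
  induction n as [|n IH]; [simpl; ring|].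
  simpl pochhammer; rewrite S_INR.
  replace (pochhammer (1 + a) n * (1 + a + INR n) * a)
    with (pochhammer (1 + a) n * a * (1 + a + INR n)) by ring.
  rewrite IH; ring.
Qed.

(** The factors [(1)_n] cancel, and [(b)_n / (1 + b)_n = b / (b + n)], which is [1 / (1 + alpha n)]
    for [b = 1 / alpha]. *)
Lemma hyp2F1_PSeries (alpha x : R) :
  0 < alpha ->
  hyp2F1 1 (1 / alpha) (1 + 1 / alpha) x
  = PSeries (fun n => 1 / (1 + alpha * INR n)) x.
Proof.
  intros Ha.
  apply Series_ext; intros n; f_equal.
  assert (Hi : 0 < 1 / alpha) by (apply Rdiv_lt_0_compat; lra).
  pose proof (pochhammer_pos 1 n ltac:(lra)).
  pose proof (pochhammer_pos (1 / alpha) n Hi).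
  pose proof (pochhammer_pos (1 + 1 / alpha) n ltac:(lra)).
  pose proof (pos_INR n).
  assert (0 < 1 + alpha * INR n) by nra.
  pose proof (pochhammer_shift (1 / alpha) n) as E.
  assert (E' : pochhammer (1 + 1 / alpha) n
               = pochhammer (1 / alpha) n * (1 + alpha * INR n)).
  { apply (Rmult_eq_reg_r (1 / alpha)); [|lra].
    rewrite E; field; lra. }
  rewrite E'; field; lra.
Qed.

Lemma G1_PSeries (alpha M x : R) :
  0 < alpha ->
  G1 alpha M x = x * PSeries (fun n => 1 / (1 + alpha * INR n)) x
                 - 1 / (2 * (M - alpha + 1)).
Proof.
  intros Ha; unfold G1; rewrite hyp2F1_PSeries by exact Ha; reflexivity.
Qed.

(** Partial fractions: [alpha (n + 2) / (1 + alpha n) = 1 + (2 alpha - 1) / (1 + alpha n)], and the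
    constant 1 sums to the geometric term [x / (1 - x)]. *)
Lemma G2_PSeries (alpha M x : R) :
  0 < alpha -> 0 < x < 1 ->
  G2 alpha M x
  = x * PSeries (fun n => alpha * INR (S (S n)) / (1 + alpha * INR n)) x
    - alpha / (2 * (M - alpha + 1)).
Proof.
  intros Ha Hx; unfold G2; rewrite hyp2F1_PSeries by exact Ha.
  f_equal.
  assert (Hpos : forall n, 1 <= 1 + alpha * INR n)
    by (intros n; pose proof (pos_INR n); nra).
  assert (Hg : ex_series (fun n => x ^ n))
    by (apply ex_series_geom; rewrite Rabs_pos_eq; lra).
  assert (Hf : ex_series (fun n => 1 / (1 + alpha * INR n) * x ^ n)).
  { apply (ex_series_bounded_coefficients _ 1); [|lra].
    intros n; specialize (Hpos n); split.
    - apply Rlt_le, Rdiv_lt_0_compat; lra.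
    - apply (Rmult_le_reg_r (1 + alpha * INR n)); [lra|].
      unfold Rdiv; rewrite Rmult_assoc, Rinv_l; lra. }
  rewrite !PSeries_as_Series.
  rewrite (Series_ext (fun n => alpha * INR (S (S n)) / (1 + alpha * INR n) * x ^ n)
    (fun n => x ^ n + (2 * alpha - 1) * (1 / (1 + alpha * INR n) * x ^ n))).
  2:{ intros n; specialize (Hpos n); rewrite !S_INR; field; lra. }
  rewrite Series_plus, Series_scal_l, Series_geom.
  - field; lra.
  - rewrite Rabs_pos_eq; lra.
  - exact Hg.
  - apply (ex_series_scal_l (V := R_NormedModule)), Hf.
Qed.

(** As [C0] is the reciprocal of [K], the root equation says that the majorant [C0 * c k] sums to
    exactly 1. *)
Lemma weighted_sum_le_1 (c w : nat -> R) (B C0 K r : R) :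
  (forall n, 0 <= c n <= B) -> 0 < r < 1 -> r * PSeries c r = K ->
  C0 * K = 1 -> (forall k, 0 <= w k <= C0 * c k) ->
  ex_series (fun k => w k * r ^ S k) /\ Series (fun k => w k * r ^ S k) <= 1.
Proof.
  intros Hc Hr HK HC Hw.
  assert (Hex : ex_series (fun k => C0 * r * (c k * r ^ k))).
  { apply (ex_series_scal_l (V := R_NormedModule)).
    apply (ex_series_bounded_coefficients c B); [exact Hc|lra]. }
  assert (Hle : forall k, 0 <= w k * r ^ S k <= C0 * r * (c k * r ^ k)).
  { intros k; specialize (Hw k).
    assert (0 <= r ^ S k) by (apply pow_le; lra).
    split; [apply Rmult_le_pos; lra|].
    replace (C0 * r * (c k * r ^ k)) with (C0 * c k * r ^ S k) by (simpl; ring).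
    apply Rmult_le_compat_r; lra. }
  split.
  - apply (ex_series_le (V := R_CompleteNormedModule) _ _) with (2 := Hex).
    intros k.
    change (Rabs (w k * r ^ S k) <= C0 * r * (c k * r ^ k)).
    rewrite Rabs_pos_eq; apply Hle.
  - eapply Rle_trans; [apply Series_le; [exact Hle|exact Hex]|].
    rewrite Series_scal_l, <- PSeries_as_Series, <- HC, <- HK.
    right; ring.
Qed.

(** * Coefficient bounds *)

Local Open Scope C_scope.

(** The expansion hypotheses constrain [a n] only for [n >= 2], so the first two entries are
    replaced by the normalised ones: [c1] is 1 for [h] and 0 for [g]. *)
Definition coefficients (c1 : C) (a : nat -> C) (n : nat) : C :=
  match n with
  | O => 0
  | S O => c1
  | _ => a n
  end.

Lemma has_tail_expansion_shift (a : nat -> C) (z s : C) :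
  has_tail_expansion a z s ->
  is_Cseries (fun k => a (k + 2)%nat * z ^ S (S k)) s.
Proof.
  apply is_Cseries_ext; intros k.
  do 2 f_equal; lia.
Qed.

Lemma disk_series_of_tail (c1 : C) (a : nat -> C) (h : C -> C) :
  (forall z, unit_disk z -> has_tail_expansion a z (h z - c1 * z)) ->
  disk_series (coefficients c1 a) h.
Proof.
  intros H z Hz.
  specialize (H z Hz); apply has_tail_expansion_shift in H.
  replace (h z) with (coefficients c1 a 0 * z ^ 0
    + (coefficients c1 a 1 * z ^ 1 + (h z - c1 * z))) by (simpl; ring).
  apply (is_Cseries_cons (fun n => coefficients c1 a n * z ^ n)).
  apply (is_Cseries_cons (fun n => coefficients c1 a (S n) * z ^ S n)).
  revert H; apply is_Cseries_ext; intros k.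
  simpl coefficients; do 2 f_equal; lia.
Qed.

(** Multiplication by [z] moves the coefficient [n (n + 1) c (n + 1)] of the second derivative to
    order [n], with nothing at order 0. *)
Lemma disk_series_operator (alpha : R) (c : nat -> C) (h : C -> C) :
  disk_series c h ->
  disk_series (fun n => (1 - alpha + alpha * INR n)%R * (INR (S n) * c (S n)))
    (fun z => (1 - alpha)%R * C_derive h z
              + alpha * z * C_derive (C_derive h) z).
Proof.
  intros H z Hz.
  pose proof (disk_series_C_derive _ _ H) as H1.
  pose proof (disk_series_C_derive _ _ H1) as H2.
  apply is_Cseries_ext with (fun n =>
    (1 - alpha)%R * (INR (S n) * c (S n) * z ^ n)
    + alpha * z * (match n with
                   | O => 0
                   | S k => INR (S k) * (INR (S (S k)) * c (S (S k))) * z ^ k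
                   end)).
  { intros [|k].
    - simpl INR; rewrite Rmult_0_r, Rplus_0_r; ring.
    - rewrite Cpow_S, RtoC_plus, RtoC_mult; ring. }
  apply is_Cseries_plus; apply is_Cseries_scal; [apply H1, Hz|].
  specialize (H2 z Hz).
  replace (C_derive (C_derive h) z) with (0 + C_derive (C_derive h) z) by ring.
  apply (is_Cseries_cons (fun n => match n with
     | O => RtoC 0
     | S k => INR (S k) * (INR (S (S k)) * c (S (S k))) * z ^ k
     end)).
  exact H2.
Qed.

Lemma disk_series_plus_const (c : nat -> C) (h : C -> C) (x : C) :
  disk_series c h ->
  disk_series (fun n => c n + if Nat.eq_dec n 0 then x else RtoC 0)
    (fun z => h z + x).
Proof.
  intros H z Hz.
  apply is_Cseries_ext with
    (fun n => c n * z ^ n + if Nat.eq_dec n 0 then x else RtoC 0).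
  - intros n; destruct (Nat.eq_dec n 0) as [E|E]; [subst n; simpl|]; ring.
  - apply is_Cseries_plus; [apply H, Hz|apply is_Cseries_single].
Qed.

Lemma class_PH0_coefficient_bound (M alpha : R) (f h g : C -> C)
  (a b : nat -> C) (k : nat) :
  (0 < alpha)%R -> class_PH0 alpha M f h g ->
  (forall z, unit_disk z -> has_tail_expansion a z (h z - z)) ->
  (forall z, unit_disk z -> has_tail_expansion b z (g z)) ->
  (INR (S (S k)) * (Cmod (a (k + 2)%nat) + Cmod (b (k + 2)%nat))
   <= 2 * (M - alpha + 1) * (1 / (1 + alpha * INR k)))%R.
Proof.
  intros Ha Hf Hh Hg.
  assert (Dh : disk_series (coefficients 1 a) h).
  { apply disk_series_of_tail; intros z Hz.
    rewrite Cmult_1_l; apply Hh, Hz. }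
  assert (Dg : disk_series (coefficients 0 b) g).
  { apply disk_series_of_tail; intros z Hz.
    replace (g z - 0 * z) with (g z) by ring; apply Hg, Hz. }
  pose proof (disk_series_plus_const _ _ (RtoC M)
    (disk_series_operator alpha _ _ Dh)) as DP.
  pose proof (disk_series_operator alpha _ _ Dg) as DQ.
  (* Order [k + 1] carries [a (k + 2)] and [b (k + 2)], with factor
     [1 - alpha + alpha (k + 1) = 1 + alpha k]; the constant coefficient for [h] is
     [1 - alpha + M]. *)
  pose proof (caratheodory_pair _ _ _ _ (S k) DP DQ) as H.
  cbv beta in H.
  assert (Hk : (0 < 1 + alpha * INR k)%R) by (pose proof (pos_INR k); nra).
  assert (E : forall x : C, Cmod ((1 - alpha + alpha * INR (S k))%R
      * (INR (S (S k)) * x))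
    = ((1 + alpha * INR k) * (INR (S (S k)) * Cmod x))%R).
  { intros x; rewrite !Cmod_mult, !Cmod_R, (Rabs_pos_eq (INR _)) by apply pos_INR.
    replace (1 - alpha + alpha * INR (S k))%R with (1 + alpha * INR k)%R
      by (rewrite S_INR; ring).
    rewrite Rabs_pos_eq by lra; reflexivity. }
  destruct (Nat.eq_dec (S k) 0) as [Ek|_]; [lia|].
  destruct (Nat.eq_dec 0 0) as [_|E0]; [|lia].
  rewrite Cplus_0_r, !E in H.
  replace (k + 2)%nat with (S (S k)) by lia.
  simpl coefficients in H.
  apply (Rmult_le_reg_l (1 + alpha * INR k)); [exact Hk|].
  replace ((1 + alpha * INR k) * (2 * (M - alpha + 1) * (1 / (1 + alpha * INR k))))%R
    with (2 * (M - alpha + 1))%R by (field; lra).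
  rewrite Rmult_plus_distr_l, Rmult_plus_distr_l.
  eapply Rle_trans; [apply H|].
  - intros z Hz.
    pose proof (class_PH0_ineq _ _ _ _ _ Hf z Hz) as Hi.
    set (Pz := (1 - alpha)%R * C_derive h z + _) in *.
    change (Re (Pz + M)) with (Re Pz + M)%R; lra.
  - simpl; ring.
  - lia.
  - right; unfold Re; simpl; ring.
Qed.

Lemma class_PH0_tail_expansion (M alpha : R) (f h g : C -> C) (a b : nat -> C) :
  class_PH0 alpha M f h g ->
  (forall z, unit_disk z -> has_tail_expansion a z (h z - z)) ->
  (forall z, unit_disk z -> has_tail_expansion b z (g z)) ->
  harmonic_tail_expansion (fun k => a (k + 2)%nat) (fun k => b (k + 2)%nat) f.
Proof.
  intros Hf Hh Hg z Hz.
  rewrite (class_H_decomp _ _ _ (class_PH0_H _ _ _ _ _ Hf) z Hz).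
  replace (h z + Cconj (g z) - z) with (h z - z + Cconj (g z)) by ring.
  apply is_Cseries_plus; [|apply is_Cseries_conj];
    apply has_tail_expansion_shift; [apply Hh|apply Hg]; exact Hz.
Qed.

Local Close Scope C_scope.

Theorem theorem2p5 (M alpha : R) (hM : 0 < M) (halpha : 0 < alpha <= 1)
  (f h g : C -> C) (a b : nat -> C)
  (hf : class_PH0 alpha M f h g)
  (hh : forall z : C, unit_disk z -> has_tail_expansion a z (h z - z)%C)
  (hg : forall z : C, unit_disk z -> has_tail_expansion b z (g z)) :
  (exists rstar : R,
      smallest_root_01 (G1 alpha M) rstar /\ starlike_in_disk f rstar) /\
  (exists rc : R,
      smallest_root_01 (G2 alpha M) rc /\ convex_in_disk f rc).
Proof.
  assert (Hpos : forall n, 1 <= 1 + alpha * INR n)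
    by (intros n; pose proof (pos_INR n); nra).
  (* Here [alpha <= 1] gives [1 + alpha n <= n + 1], the harmonic lower bound that places the roots
     below 1. *)
  assert (Hinv : forall n, 1 / INR (S n) <= 1 / (1 + alpha * INR n) <= 1).
  { intros n; specialize (Hpos n); pose proof (pos_INR n).
    unfold Rdiv; rewrite !Rmult_1_l; split.
    - apply Rinv_le_contravar; [lra|rewrite S_INR; nra].
    - rewrite <- Rinv_1; apply Rinv_le_contravar; lra. }
  assert (Hinv0 : forall n, 0 < 1 / INR (S n))
    by (intros n; apply Rdiv_lt_0_compat; [lra|apply lt_0_INR; lia]).
  set (d := fun k => (Cmod (a (k + 2)%nat) + Cmod (b (k + 2)%nat))%R).
  assert (Hd : forall k, 0 <= d k).
  { intros k; apply Rplus_le_le_0_compat; apply Cmod_ge_0. }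
  pose proof (fun k => class_PH0_coefficient_bound M alpha f h g a b k
    (proj1 halpha) hf hh hg) as Hcoef.
  pose proof (class_PH0_tail_expansion M alpha f h g a b hf hh hg) as Htail.
  split.
  - destruct (smallest_root_exists (fun n => 1 / (1 + alpha * INR n)) (G1 alpha M)
      1 1 (1 / (2 * (M - alpha + 1)))) as [r Hr].
    + lra.
    + apply Rdiv_lt_0_compat; lra.
    + exact Hinv.
    + intros x _; apply G1_PSeries; lra.
    + exists r; split; [exact Hr|].
      destruct Hr as [Hr [Er _]].
      rewrite G1_PSeries in Er by lra.
      destruct (weighted_sum_le_1 (fun n => 1 / (1 + alpha * INR n))
        (fun k => INR (S (S k)) * d k) 1 (2 * (M - alpha + 1))
        (1 / (2 * (M - alpha + 1))) r) as [Hex Hle].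
      * intros n; specialize (Hinv n); specialize (Hinv0 n); lra.
      * exact Hr.
      * lra.
      * field; lra.
      * intros k; split; [|apply Hcoef].
        apply Rmult_le_pos; [apply pos_INR|apply Hd].
      * apply (starlike_of_coefficients _ _ f r Htail); try assumption.
        pose proof (class_PH0_H _ _ _ _ _ hf) as HH.
        rewrite (class_H_decomp _ _ _ HH)
          by (unfold unit_disk; rewrite Cmod_0; lra).
        rewrite (class_H_h0 _ _ _ HH), (class_H_g0 _ _ _ HH), Cplus_0_l.
        unfold Cconj, RtoC; simpl; rewrite Ropp_0; reflexivity.
  - set (c := fun n => alpha * INR (S (S n)) / (1 + alpha * INR n)).
    assert (Hc : forall n, alpha / INR (S n) <= c n <= 2).
    { intros n; unfold c.
      specialize (Hpos n); specialize (Hinv n); specialize (Hinv0 n).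
      pose proof (pos_INR n) as Hn; split.
      - replace (alpha / INR (S n)) with (alpha * (1 / INR (S n)))
          by (unfold Rdiv; ring).
        replace (alpha * INR (S (S n)) / (1 + alpha * INR n))
          with (alpha * (INR (S (S n)) * (1 / (1 + alpha * INR n))))
          by (unfold Rdiv; ring).
        apply Rmult_le_compat_l; [lra|].
        rewrite !S_INR in *; nra.
      - apply (Rmult_le_reg_r (1 + alpha * INR n)); [lra|].
        unfold Rdiv; rewrite Rmult_assoc, Rinv_l, Rmult_1_r, !S_INR by lra.
        nra. }
    destruct (smallest_root_exists c (G2 alpha M)
      2 alpha (alpha / (2 * (M - alpha + 1)))) as [r Hr].
    + lra.
    + apply Rdiv_lt_0_compat; lra.
    + exact Hc.
    + intros x Hx; apply G2_PSeries; lra.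
    + exists r; split; [exact Hr|].
      destruct Hr as [Hr [Er _]].
      rewrite G2_PSeries in Er by lra; fold c in Er.
      destruct (weighted_sum_le_1 c
        (fun k => INR (S (S k)) ^ 2 * d k) 2 (2 * (M - alpha + 1) / alpha)
        (alpha / (2 * (M - alpha + 1))) r) as [Hex Hle].
      * intros n; specialize (Hc n); split; [|lra].
        apply Rle_trans with (alpha / INR (S n)); [|lra].
        apply Rlt_le, Rdiv_lt_0_compat; [lra|apply lt_0_INR; lia].
      * exact Hr.
      * lra.
      * field; lra.
      * intros k; split.
        -- apply Rmult_le_pos; [apply pow_le, pos_INR|apply Hd].
        -- specialize (Hcoef k); fold (d k) in Hcoef; specialize (Hpos k).
           (* One more factor [k + 2] turns the estimate into one for the weight [(k + 2)^2]; the
              [alpha] in [c] cancels the one in [C0]. *)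
           apply (Rmult_le_compat_l (INR (S (S k)))) in Hcoef; [|apply pos_INR].
           replace (2 * (M - alpha + 1) / alpha * c k)
             with (INR (S (S k))
                   * (2 * (M - alpha + 1) * (1 / (1 + alpha * INR k))))
             by (unfold c; field; lra).
           revert Hcoef; generalize (INR (S (S k))); intros x Hx; lra.
      * apply (convex_of_coefficients _ _ f r Htail); assumption.
Qed.
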